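(* Let $P$ be a simple polygon and let $k\ge 2$. Routes $W_1,\dots,W_k$ in $P$ are $k$-hull watchman routes for $P$ if the following conditions hold: (i) every convex vertex of $P$ is visited by one of $W_1,\dots,W_k$; (ii) the visibility polygon of each convex vertex of $P$ is visited by all of the routes $W_1,\dots,W_k$; (iii) the routes $W_1,\dots,W_k$ are relatively convex.
   Context: $P$ is a simple polygon (closed region) with finitely many vertices, none of which has internal angle exactly $180^\circ$. A vertex is convex if its internal angle is strictly smaller than $180^\circ$. Points $p,q\in P$ see each other (are visible to each other) if the segment $\overline{pq}$ is contained in $P$. The visibility polygon of $p\in P$ is the set of points of $P$ visible from $p$. A route in $P$ is a closed curve contained in $P$ (it starts and ends at the same point); it visits a point if it passes through it, and visits a set if it contains at least one point of that set. A point $p\in P$ is $k$-hull-guarded by $k$ points $w_1,\dots,w_k\in P$ if the (ordinary Euclidean) convex hull of $w_1,\dots,w_k$ contains $p$ and each of $w_1,\dots,w_k$ sees $p$ (the convex hull need not be contained in $P$). Routes $W_1,\dots,W_k$ in $P$ are $k$-hull watchman routes for $P$ if for every $p\in P$ there exist points $w_i\in W_i$, $i\in\{1,\dots,k\}$, such that $p$ is $k$-hull-guarded by $w_1,\dots,w_k$. For $a,b\in P$, the geodesic $\pi(a,b)$ is the shortest path in $P$ connecting $a$ and $b$. A set $H\subseteq P$ is geodesically convex if $\pi(p,q)\subseteq H$ for all $p,q\in H$. The relative convex hull $\mathrm{H}(X)$ of $X\subseteq P$ is the smallest geodesically convex set within $P$ containing $X$; it is a weakly simple polygon. When $X$ is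 a route, $\mathrm{H}(X)$ also denotes the closed curve traversing the boundary of this set (degenerate parts are traversed back and forth). A route $W$ is relatively convex if it coincides with its relative convex hull $\mathrm{H}(W)$ in this sense. *)

(* Defs.v *)
(* Mathematical Components / MathComp-Analysis. *)
From HB Require Import structures.
From mathcomp Require Import all_boot all_order all_algebra.
From mathcomp Require Import all_classical all_reals all_analysis.

Set Implicit Arguments.
Unset Strict Implicit.
Unset Printing Implicit Defensive.
Import Order.TTheory GRing.Theory Num.Theory.
Import numFieldNormedType.Exports.

Local Open Scope classical_set_scope.
Local Open Scope ring_scope.

(* The library norm on a product is the maximum norm. It induces the usual
   topology and the usual bounded sets; lengths and angles use [enorm]. *)
Notation plane R := (R^o * R^o)%type.

Section Euclid.
Context {R : realType}.
Implicit Types x y : plane R.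

Definition dotp x y : R := x.1 * y.1 + x.2 * y.2.
Definition enorm x : R := Num.sqrt (dotp x x).
Definition segment x y : set (plane R) :=
  [set (1 - t) *: x + t *: y | t in `[0, 1]].
Definition frontier (A : set (plane R)) : set (plane R) :=
  closure A `\` interior A.

(* Convex angle between two nonzero vectors, in [0, pi]. *)
Definition angle x y : R := acos (dotp x y / (enorm x * enorm y)).
End Euclid.

Section Polygon.
Context {R : realType} {n : nat}.
Implicit Types (v : 'I_n -> plane R) (i : 'I_n).

(* Vertices in cyclic order, in either orientation; [ordS] and [ord_pred] are
   successor and predecessor modulo n. *)
Definition edge_point v i (t : R) : plane R :=
  (1 - t) *: v i + t *: v (ordS i).

Definition polygonal_curve v : set (plane R) :=
  \bigcup_i segment (v i) (v (ordS i)).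

(* Every point of the closed polygonal curve is reached only once. *)
Definition simple_polygonal_curve v : Prop :=
  forall i j (s t : R), 0 <= s < 1 -> 0 <= t < 1 ->
    edge_point v i s = edge_point v j t -> i = j /\ s = t.

(* The curve together with the bounded components of its complement. *)
Definition polygon_region v : set (plane R) :=
  polygonal_curve v `|`
  [set x | (~` polygonal_curve v) x /\
           bounded_set (connected_component (~` polygonal_curve v) x)].

Definition wedge_inside v i : Prop :=
  exists2 e : R, 0 < e & forall s t : R, 0 <= s <= e -> 0 <= t <= e ->
    polygon_region v
      (v i + s *: (v (ord_pred i) - v i) + t *: (v (ordS i) - v i)).

(* The two edges at [v i] bound a sector of angle at most pi and the
   complementary one; the internal angle is that of the sector which lies
   in the polygon near [v i]. *)
Definition internal_angle v i : R :=
  let a := angle (v (ord_pred i) - v i) (v (ordS i) - v i) in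
  if `[< wedge_inside v i >] then a else 2 * pi - a.

Definition simple_polygon v : Prop :=
  [/\ (3 <= n)%N, simple_polygonal_curve v & forall i, internal_angle v i != pi].

Definition convex_vertex v i : Prop := internal_angle v i < pi.
End Polygon.

Section Region.
Context {R : realType}.
Variable P : set (plane R).
Implicit Types (a b p q : plane R) (g : R -> plane R) (H X : set (plane R)).

Definition sees p q : Prop := segment p q `<=` P.
Definition visibility_polygon p : set (plane R) := [set q | P q /\ sees p q].

(* A curve is a map on [0, 1]; its values elsewhere are irrelevant. *)
Definition trace g : set (plane R) := g @` `[0, 1].

Definition curve_in g : Prop :=
  {within `[0, 1], continuous g} /\ trace g `<=` P.

Definition route g : Prop := curve_in g /\ g 0 = g 1.

Definition polyline_length g (s : seq R) : R :=
  let F := g \o nth 1 (0 :: s) in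
  \sum_(0 <= m < size s) enorm (F m.+1 - F m).
Definition curve_length g : \bar R :=
  ereal_sup [set (polyline_length g s)%:E | s in itv_partition 0 1].

Definition curve_from_to a b g : Prop := [/\ curve_in g, g 0 = a & g 1 = b].

Definition geodesic a b g : Prop :=
  curve_from_to a b g /\
  forall h, curve_from_to a b h -> (curve_length g <= curve_length h)%E.

Definition geodesically_convex H : Prop :=
  H `<=` P /\
  forall p q g, H p -> H q -> geodesic p q g -> trace g `<=` H.

Definition relative_hull X : set (plane R) := smallest geodesically_convex X.

(* The closed curve around a relative hull runs through exactly the frontier
   points of the hull: a degenerate part has empty interior and hence lies in
   the frontier. Routes are compared with it as point sets. *)
Definition relatively_convex g : Prop :=
  trace g = frontier (relative_hull (trace g)).

Definition hull_guarded k (w : 'I_k -> plane R) p : Prop :=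
  [/\ forall i, P (w i),
      smallest (@convex_set R (plane R)) (range w) p &
      forall i, sees (w i) p].

Definition hull_watchman_routes k (W : 'I_k -> R -> plane R) : Prop :=
  forall p, P p ->
    exists2 w : 'I_k -> plane R,
      forall i, trace (W i) (w i) & hull_guarded w p.
End Region.

Definition visits_point {R : realType} (g : R -> plane R) (x : plane R) : Prop :=
  trace g x.
Definition visits_set {R : realType} (g : R -> plane R) (A : set (plane R)) :
  Prop := (trace g `&` A) !=set0.

(* Main.v *)
(** The proof rests on a separation property of chords: if the part [C] of a line
    seen from a point [p] of the polygon [P] is missed by a polygonal path in
    [P], then the path does not lead from one side of [C] to the other. Otherwise
    close the path up through [C]: on the line, just beyond the two ends of [C],
    there are points outside [P], around which the winding number of the closed
    path vanishes, whereas it changes by one turn across [C]. The same argument,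
    applied to the boundary of [P], shows that a local lexicographic minimum of
    [P] is a convex vertex. Hence there is a convex vertex behind every chord.

    It follows first that every route sees every point [p] of [P]. If [p] lies on
    a route or inside a hull, two opposite points suffice. Otherwise the
    directions in which [p] sees a given route form a convex cone without opposite
    directions, since a segment through [p] joining two points of the route would
    be a geodesic through [p]. If [p] could not be written as a convex
    combination of one point of each route, all the seen points would lie
    strictly on one side of a line through [p]; but some route visits the convex
    vertex behind that line, hence crosses the chord of [p]. *)
Require Import Defs.
From HB Require Import structures.
From mathcomp Require Import all_boot all_order all_algebra.
From mathcomp Require Import all_classical all_reals all_analysis.
From mathcomp Require Import ring lra zify.
Import Order.TTheory GRing.Theory Num.Theory.
Import numFieldNormedType.Exports.
Local Open Scope classical_set_scope.
Local Open Scope ring_scope.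

Set Implicit Arguments.
Unset Strict Implicit.
Unset Printing Implicit Defensive.

(** * Plane vectors, their norm and the oriented angle *)

Section PlaneAlgebra.
Context {R : realType}.
Implicit Types x y z u w d : plane R.

(** Separation by a chord uses only that the region is closed, bounded and without holes: every
    outside point lies in an unbounded connected set off the region, around whose points winding
    numbers vanish. Routes are arbitrary continuous curves, whereas winding numbers are computed
    here as finite sums of angles along polygonal paths; local star-shapedness of the region turns
    connected sets into such paths.

    The choice of guards is constrained by the rule of one point per route. If no line through [p]
    has all seen points strictly on one side, at most three seen points surround [p], but two of
    them may belong to the same route. This is why the seen directions of a route are shown to form
    a convex cone: two points of one route can then be merged into a single one. *)

Definition crossp x y : R := x.1 * y.2 - x.2 * y.1.

Lemma plane_eq x y : x.1 = y.1 -> x.2 = y.2 -> x = y.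
Proof. by case: x y => [? ?] [? ?] /= -> ->. Qed.

Lemma fstD x y : (x + y).1 = x.1 + y.1 :> R. Proof. by []. Qed.
Lemma sndD x y : (x + y).2 = x.2 + y.2 :> R. Proof. by []. Qed.
Lemma fstN x : (- x).1 = - x.1 :> R. Proof. by []. Qed.
Lemma sndN x : (- x).2 = - x.2 :> R. Proof. by []. Qed.
Lemma fstZ (a : R) x : (a *: x).1 = a * x.1 :> R. Proof. by []. Qed.
Lemma sndZ (a : R) x : (a *: x).2 = a * x.2 :> R. Proof. by []. Qed.
Definition coordE := (fstD, sndD, fstN, sndN, fstZ, sndZ).

Lemma enorm_ge0 x : 0 <= enorm x.
Proof. exact: sqrtr_ge0. Qed.

Lemma dotp_ge0 x : 0 <= dotp x x.
Proof. by rewrite /dotp -!expr2 addr_ge0 ?sqr_ge0. Qed.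

Lemma enorm_sqr x : enorm x ^+ 2 = dotp x x.
Proof. by rewrite sqr_sqrtr ?dotp_ge0. Qed.

Lemma dotp_eq0 x : (dotp x x == 0) = (x == 0).
Proof.
rewrite /dotp -!expr2 paddr_eq0 ?sqr_ge0// !sqrf_eq0.
by case: x => a b; rewrite xpair_eqE.
Qed.

Lemma enorm_gt0 x : (0 < enorm x) = (x != 0).
Proof. by rewrite sqrtr_gt0 lt_neqAle dotp_ge0 andbT eq_sym dotp_eq0. Qed.

Lemma lagrange_id x y : (dotp x y) ^+ 2 + (crossp x y) ^+ 2 = dotp x x * dotp y y.
Proof. rewrite /dotp /crossp; ring. Qed.

Lemma dotp_le x y : `|dotp x y| <= enorm x * enorm y.
Proof.
rewrite -ler_sqr ?nnegrE ?mulr_ge0 ?enorm_ge0// exprMn !enorm_sqr -lagrange_id.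
by rewrite real_normK ?num_real// lerDl sqr_ge0.
Qed.

(* Half-angle formula [tan (a / 2) = sin a / (1 + cos a)]; the junk value at
   antiparallel vectors is [0]. *)
Definition arg x y : R := 2 * atan (crossp x y / (enorm x * enorm y + dotp x y)).

Lemma segmentP x y z :
  segment x y z <-> exists2 t : R, 0 <= t <= 1 & z = (1 - t) *: x + t *: y.
Proof.
split; first by move=> [t]; rewrite /= in_itv /= => t01 <-; exists t.
by move=> [t t01 ->]; exists t => //=; rewrite in_itv.
Qed.

(** The denominator of [arg] vanishes only in the antiparallel equality case of Cauchy-Schwarz,
    which puts [z] between [x] and [y]. *)
Lemma arg_wd x y z : ~ segment x y z ->
  0 < enorm (x - z) * enorm (y - z) + dotp (x - z) (y - z).
Proof.
move=> nz; set u := x - z; set w := y - z.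
have uw := dotp_le u w.
rewrite lt_neqAle; apply/andP; split; last first.
  by move: uw; rewrite ler_norml => /andP[]; lra.
apply/negP => /eqP e; apply: nz.
have u0 := enorm_ge0 u; have w0 := enorm_ge0 w.
have [uw0|uw0] := eqVneq (enorm u + enorm w) 0.
  have u00 : ~~ (0 < enorm u) by rewrite -leNgt; lra.
  move: u00; rewrite enorm_gt0 negbK subr_eq0 => /eqP xz.
  apply/segmentP; exists 0; first by rewrite lexx ler01.
  by rewrite subr0 scale1r scale0r addr0.
have s0 : 0 < enorm u + enorm w by rewrite lt_neqAle eq_sym uw0 addr_ge0.
(* In the equality case this combination is the zero vector; divided by the sum of the norms, it
   exhibits [z] as a weighted mean of [x] and [y]. *)
have : dotp (enorm w *: u + enorm u *: w) (enorm w *: u + enorm u *: w) = 0.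
  have -> : dotp (enorm w *: u + enorm u *: w) (enorm w *: u + enorm u *: w) =
     enorm w ^+ 2 * dotp u u + enorm u ^+ 2 * dotp w w + 2 * (enorm u * enorm w) * dotp u w.
    rewrite /dotp !coordE; ring.
  rewrite -!enorm_sqr.
  have -> : dotp u w = - (enorm u * enorm w) by lra.
  ring.
move/eqP; rewrite dotp_eq0 => /eqP h.
apply/segmentP; exists (enorm u / (enorm u + enorm w)).
  by rewrite divr_ge0 ?ler_pdivrMr ?mul1r// ?lerDl// ltW.
have h1 : enorm w * (x.1 - z.1) + enorm u * (y.1 - z.1) = 0 by have := congr1 fst h.
have h2 : enorm w * (x.2 - z.2) + enorm u * (y.2 - z.2) = 0 by have := congr1 snd h.
apply: plane_eq; rewrite !coordE.
  apply: (mulfI uw0). rewrite -[LHS]addr0 -{}h1. field. exact: uw0.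
apply: (mulfI uw0). rewrite -[LHS]addr0 -{}h2. field. exact: uw0.
Qed.
End PlaneAlgebra.

(** * Winding numbers of polygonal paths *)

Section Winding.
Context {R : realType}.
Implicit Types x y z u w d : plane R.

Lemma crosspC x y : crossp y x = - crossp x y.
Proof. rewrite /crossp; ring. Qed.

Lemma dotpC x y : dotp y x = dotp x y.
Proof. rewrite /dotp; ring. Qed.

Lemma argC x y : arg y x = - arg x y.
Proof. by rewrite /arg crosspC dotpC (mulrC (enorm y)) mulNr atanN mulrN. Qed.

Section CosSin.
Context (u w : plane R) (uw : 0 < enorm u * enorm w + dotp u w).
Let N := enorm u * enorm w.
Let N0 : 0 < N.
Proof. by have := dotp_le u w; rewrite ler_norml => /andP[_]; rewrite /N; move: uw; lra. Qed.
Let t := crossp u w / (N + dotp u w).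
Let sqrt_t : (Num.sqrt (1 + t ^+ 2))^-1 ^+ 2 = (N + dotp u w) / (2 * N).
Proof.
have h : dotp u w ^+ 2 + crossp u w ^+ 2 = N ^+ 2.
  by rewrite lagrange_id /N exprMn !enorm_sqr.
rewrite exprVn sqr_sqrtr ?addr_ge0 ?sqr_ge0//.
have -> : 1 + t ^+ 2 = 2 * N / (N + dotp u w).
  rewrite /t expr_div_n.
  have -> : crossp u w ^+ 2 = N ^+ 2 - dotp u w ^+ 2 by rewrite -h; ring.
  by field; rewrite gt_eqF.
by rewrite invf_div.
Qed.

Lemma arg_cos : enorm u * enorm w * cos (arg u w) = dotp u w.
Proof.
rewrite /arg mulr_natl cos_mulr2n cos_atan sqrt_t -/N mulr2n.
by field; rewrite gt_eqF.
Qed.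

Lemma arg_sin : enorm u * enorm w * sin (arg u w) = crossp u w.
Proof.
have c0 : cos (atan t) != 0.
  by rewrite gt_eqF// cos_gt0_pihalf// atan_gtNpi2 atan_ltpi2.
rewrite /arg mulr_natl sin_mulr2n -/N -/t.
have -> : sin (atan t) = t * cos (atan t) by rewrite -{2}[t]atanK /tan divfK.
transitivity (2 * N * t * cos (atan t) ^+ 2); first ring.
by rewrite cos_atan sqrt_t /t; field; rewrite !gt_eqF.
Qed.
End CosSin.

Lemma arg_itv u w : - pi < arg u w < pi.
Proof.
rewrite /arg; move: (_ / _) => t.
have := atan_gtNpi2 t; have := atan_ltpi2 t; lra.
Qed.

Lemma arg_gt0 u w : 0 < enorm u * enorm w + dotp u w -> 0 < crossp u w -> 0 < arg u w.
Proof.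
by move=> h c0; rewrite /arg mulr_gt0// -[ltLHS]atan0 lt_atan// divr_gt0.
Qed.

Lemma arg_lt0 u w : 0 < enorm u * enorm w + dotp u w -> crossp u w < 0 -> arg u w < 0.
Proof. by move=> h c0; rewrite -oppr_gt0 -argC arg_gt0 1?crosspC ?oppr_gt0// mulrC dotpC. Qed.

Lemma cos_eq1_small (x : R) : cos x = 1 -> `|x| < 2 * pi -> x = 0.
Proof.
move=> cx xpi.
have h : cos (x / 2) ^+ 2 = 1.
  have : cos ((x / 2) *+ 2) = 1 by rewrite -mulr_natr divfK.
  rewrite cos_mulr2n; lra.
have s0 : sin (x / 2) = 0.
  have s2 : sin (x / 2) ^+ 2 = 0 by have := cos2Dsin2 (x / 2); rewrite h; lra.
  by apply/eqP; rewrite -sqrf_eq0 s2.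
have [x0|x0|->//] := ltgtP x 0.
  have : 0 < sin (- (x / 2)) by rewrite sin_gt0_pi//; move: xpi; rewrite ltr_norml; lra.
  by rewrite sinN s0 oppr0 ltxx.
have : 0 < sin (x / 2) by rewrite sin_gt0_pi//; move: xpi; rewrite ltr_norml; lra.
by rewrite s0 ltxx.
Qed.

Fixpoint chain (A : set (plane R)) x (s : seq (plane R)) : Prop :=
  if s is y :: s' then segment x y `<=` A /\ chain A y s' else True.

(** For a closed chain that avoids [z] this is [2 * pi] times the winding number around [z]. *)
Fixpoint wsum z x (s : seq (plane R)) : R :=
  if s is y :: s' then arg (x - z) (y - z) + wsum z y s' else 0.

Lemma wsum_cat z x s1 s2 : wsum z x (s1 ++ s2) = wsum z x s1 + wsum z (last x s1) s2.
Proof. by elim: s1 x => [|y s IH] x /=; rewrite ?add0r// IH addrA. Qed.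

Lemma chain_cat A x s1 s2 : chain A x (s1 ++ s2) <-> chain A x s1 /\ chain A (last x s1) s2.
Proof. by elim: s1 x => [|y s IH] x /=; [tauto|rewrite IH; tauto]. Qed.

Lemma sub_chain A B x s : A `<=` B -> chain A x s -> chain B x s.
Proof.
by move=> AB; elim: s x => //= y s IH x [xA /IH]; split => //; exact: subset_trans AB.
Qed.

(** Angles add as the complex numbers [dotp + i crossp] multiply, up to the factor |v|^2. Stated
    through cosine and sine, [a] and [b] are not tied to a principal range. *)
Lemma arg_add_cos u v w (a b : R) : 0 < enorm v ->
  enorm u * enorm v * cos a = dotp u v -> enorm u * enorm v * sin a = crossp u v ->
  enorm v * enorm w * cos b = dotp v w -> enorm v * enorm w * sin b = crossp v w ->
  enorm u * enorm w * cos (a + b) = dotp u w.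
Proof.
move=> v0 ca sa cb sb; rewrite cosD.
apply: (mulfI (lt0r_neq0 (mulr_gt0 v0 v0))).
transitivity (enorm u * enorm v * cos a * (enorm v * enorm w * cos b) -
  enorm u * enorm v * sin a * (enorm v * enorm w * sin b)); first ring.
by rewrite ca sa cb sb -expr2 enorm_sqr /dotp /crossp; ring.
Qed.

Lemma arg_add_sin u v w (a b : R) : 0 < enorm v ->
  enorm u * enorm v * cos a = dotp u v -> enorm u * enorm v * sin a = crossp u v ->
  enorm v * enorm w * cos b = dotp v w -> enorm v * enorm w * sin b = crossp v w ->
  enorm u * enorm w * sin (a + b) = crossp u w.
Proof.
move=> v0 ca sa cb sb; rewrite sinD.
apply: (mulfI (lt0r_neq0 (mulr_gt0 v0 v0))).
transitivity (enorm u * enorm v * sin a * (enorm v * enorm w * cos b) +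
  enorm u * enorm v * cos a * (enorm v * enorm w * sin b)); first ring.
by rewrite ca sa cb sb -expr2 enorm_sqr /dotp /crossp; ring.
Qed.

Lemma segment_l x y : segment x y x.
Proof. by apply/segmentP; exists 0; rewrite ?lexx ?ler01// subr0 scale1r scale0r addr0. Qed.

Lemma segment_r x y : segment x y y.
Proof. by apply/segmentP; exists 1; rewrite ?lexx ?ler01// subrr scale1r scale0r add0r. Qed.

Lemma wsum_cos_sin z x s : x != z -> chain (~` [set z]) x s ->
  let l := last x s in
  enorm (x - z) * enorm (l - z) * cos (wsum z x s) = dotp (x - z) (l - z) /\
  enorm (x - z) * enorm (l - z) * sin (wsum z x s) = crossp (x - z) (l - z).
Proof.
elim: s x => [|y s IH] x xz /=.
  move=> _; rewrite cos0 sin0 mulr1 mulr0 -expr2 enorm_sqr; split=> //.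
  by rewrite /crossp; ring.
move=> [xy ch].
have yz : y != z by apply/eqP => yz; apply: (xy y (segment_r x y)).
have [cb sb] := IH y yz ch.
have nz : ~ segment x y z by move=> /xy; exact.
have wd := arg_wd nz.
have v0 : 0 < enorm (y - z) by rewrite enorm_gt0 subr_eq0.
by split; [apply: arg_add_cos v0 _ _ cb sb|apply: arg_add_sin v0 _ _ cb sb];
  rewrite ?arg_cos ?arg_sin.
Qed.

Lemma fst_continuous : continuous (fun x : plane R => x.1 : R).
Proof. by move=> x; exact: cvg_fst. Qed.

Lemma snd_continuous : continuous (fun x : plane R => x.2 : R).
Proof. by move=> x; exact: cvg_snd. Qed.

Lemma enorm_cont {T : topologicalType} (f : T -> plane R) t :
  {for t, continuous f} -> {for t, continuous (fun t => enorm (f t))}.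
Proof.
move=> cf; apply: (@continuous_comp _ _ _ (fun t => dotp (f t) (f t)) Num.sqrt);
  last exact: sqrt_continuous.
by apply: continuousD; apply: continuousM;
 (apply: (continuous_comp (f := f)); [exact: cf|]); 
 first [exact: fst_continuous|exact: snd_continuous].
Qed.

Lemma dotp_cont {T : topologicalType} (f g : T -> plane R) t :
  {for t, continuous f} -> {for t, continuous g} -> {for t, continuous (fun t => dotp (f t) (g t))}.
Proof.
move=> cf cg; apply: continuousD; apply: continuousM;
  first [apply: (continuous_comp (f := f)); [exact: cf|]
        |apply: (continuous_comp (f := g)); [exact: cg|]];
 first [exact: fst_continuous|exact: snd_continuous].
Qed.

Lemma crossp_cont {T : topologicalType} (f g : T -> plane R) t :
  {for t, continuous f} -> {for t, continuous g} ->
  {for t, continuous (fun t => crossp (f t) (g t))}.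
Proof.
move=> cf cg; apply: continuousB; apply: continuousM;
  first [apply: (continuous_comp (f := f)); [exact: cf|]
        |apply: (continuous_comp (f := g)); [exact: cg|]];
 first [exact: fst_continuous|exact: snd_continuous].
Qed.

Lemma arg_cont {T : topologicalType} (f g : T -> plane R) t :
  {for t, continuous f} -> {for t, continuous g} ->
  0 < enorm (f t) * enorm (g t) + dotp (f t) (g t) ->
  {for t, continuous (fun t => arg (f t) (g t))}.
Proof.
move=> cf cg h; apply: continuousM; first exact: cvg_cst.
apply: (@continuous_comp _ _ _
  (fun t => crossp (f t) (g t) / (enorm (f t) * enorm (g t) + dotp (f t) (g t))) atan);
  last exact: continuous_atan.
apply: continuousM; first exact: crossp_cont.
apply: continuousV; first by rewrite gt_eqF.
by apply: continuousD; [apply: continuousM; exact: enorm_cont|exact: dotp_cont].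
Qed.

Lemma sub_cont x z : {for z, continuous (fun z => x - z)}.
Proof. by apply: continuousB; [exact: cvg_cst|exact: cvg_id]. Qed.

Lemma wsum_cont z x s : chain (~` [set z]) x s -> {for z, continuous (fun z => wsum z x s)}.
Proof.
elim: s x => [|y s IH] x /=; first by move=> _; exact: cvg_cst.
move=> [xy ch]; apply: (@continuousD _ _ _ (fun z => arg (x - z) (y - z))
  (fun z => wsum z y s)); last exact: IH.
apply: arg_cont; [exact: sub_cont|exact: sub_cont|].
by apply: arg_wd => /xy; exact.
Qed.

(** The image of [F] is an interval containing 0: a value of modulus at least [2 * pi] would force
    the value pi or - pi, whose cosine is -1. *)
Lemma cos_eq1_connected (U : set (plane R)) (F : plane R -> R) z0 :
  connected U -> (forall z, U z -> {for z, continuous F}) ->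
  (forall z, U z -> cos (F z) = 1) -> U z0 -> F z0 = 0 ->
  forall z, U z -> F z = 0.
Proof.
move=> cU cF F1 Uz0 Fz0 z Uz.
have cFU : connected (F @` U).
  apply: connected_continuous_connected => //.
  by apply: continuous_in_subspaceT => x /set_mem Ux; exact: cF.
have iFU : is_interval (F @` U) by apply/connected_intervalP.
apply: cos_eq1_small; first exact: F1.
rewrite ltNge; apply/negP => Fpi.
have pi0 := pi_gt0 R.
have noval c : 0 <= c <= F z \/ F z <= c <= 0 -> cos c = 1.
  move=> h; have [y Uy <-] : (F @` U) c; last exact: F1.
  have E0 : (F @` U) 0 by exists z0.
  have Ez : (F @` U) (F z) by exists z.
  by case: h => h; [exact: (iFU _ _ E0 Ez)|exact: (iFU _ _ Ez E0)].
have [Fz|Fz] := leP 0 (F z).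
  have : cos pi = 1 :> R by apply: noval; left; move: Fpi; rewrite ger0_norm//; lra.
  rewrite cospi; lra.
have : cos (- pi) = 1 :> R by apply: noval; right; move: Fpi; rewrite ltr0_norm//; lra.
rewrite cosN cospi; lra.
Qed.

Lemma unboundedP (U : set (plane R)) : ~ bounded_set U -> forall M : R, exists2 z, U z & M < `|z|.
Proof.
move=> nb M; apply: contrapT => h; apply: nb.
exists M; split; first exact: num_real.
move=> N MN x Ux; change (`|x| <= N); rewrite leNgt; apply/negP => Nx.
by apply: h; exists x => //; exact: lt_trans Nx.
Qed.

Lemma norm_fst_le x : `|x.1 : R| <= `|x|.
Proof. by rewrite /Num.norm /= le_max lexx. Qed.

Lemma norm_snd_le x : `|x.2 : R| <= `|x|.
Proof. by rewrite /Num.norm /= le_max lexx orbT. Qed.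

(** In the maximum norm [dotp x z] is at most 2 |x| |z| and [dotp z z] is at least |z|^2; hence the
    factor 2. *)
Lemma far_half_plane x z : 2 * `|x| < `|z| -> 0 < dotp (x - z) (- z).
Proof.
move=> h.
have h1 := norm_fst_le x; have h2 := norm_snd_le x.
have x0 : 0 <= `|x| by [].
have hz : `|z| ^+ 2 <= dotp z z /\ `|z.1 : R| <= `|z| /\ `|z.2 : R| <= `|z|.
  split; last by split; [exact: norm_fst_le|exact: norm_snd_le].
  have -> : `|z| = Num.max `|z.1 : R| `|z.2 : R| by [].
  rewrite /dotp -!expr2.
  by case: (leP `|z.1 : R| `|z.2 : R|) => _; rewrite real_normK ?num_real// ?lerDr ?lerDl sqr_ge0.
have [z1 [z2 z3]] := hz.
have -> : dotp (x - z) (- z) = dotp z z - dotp x z by rewrite /dotp !coordE; ring.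
have : dotp x z <= 2 * `|x| * `|z|.
  apply: le_trans (ler_norm _) _; rewrite /dotp.
  apply: le_trans (ler_normD _ _) _; rewrite !normrM.
  have : `|x.1 : R| * `|z.1 : R| <= `|x| * `|z| by apply: ler_pM.
  have : `|x.2 : R| * `|z.2 : R| <= `|x| * `|z| by apply: ler_pM.
  lra.
have : 2 * `|x| * `|z| < `|z| * `|z| by rewrite ltr_pM2r//; apply: le_lt_trans h; lra.
move: z1; rewrite expr2; lra.
Qed.

(** Every vertex is seen from [z] within a right angle of [d], so the angles telescope without jumps
    of [2 * pi]. *)
Lemma wsum_half_plane z d x s :
  0 < dotp (x - z) d -> (forall y, y \in s -> 0 < dotp (y - z) d) ->
  chain (~` [set z]) x s ->
  wsum z x s = arg (x - z) d - arg (last x s - z) d.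
Proof.
elim: s x => [|y s IH] x xd sd /=; first by rewrite subrr.
move=> [xy ch]; rewrite IH ?sd ?mem_head//; last first.
  by move=> y' y's; apply: sd; rewrite in_cons y's orbT.
have yd : 0 < dotp (y - z) d by apply: sd; rewrite mem_head.
have [n1 n2] : x != z /\ y != z.
  split; apply/eqP => e; first by move: xd; rewrite e subrr /dotp /= !mul0r addr0 ltxx.
  by move: yd; rewrite e subrr /dotp /= !mul0r addr0 ltxx.
have d0 : d != 0.
  by apply/eqP => e; move: xd; rewrite e /dotp /= !mulr0 addr0 ltxx.
have small v : 0 < dotp v d -> v != 0 -> - (pi / 2) < arg v d < pi / 2.
  move=> vd v0.
  have h : 0 < enorm v * enorm d + dotp v d by rewrite addr_gt0// mulr_gt0 ?enorm_gt0.
  have c0 : 0 < cos (arg v d).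
    by move: vd; rewrite -arg_cos// pmulr_rgt0// mulr_gt0// enorm_gt0.
  have /andP[i1 i2] := arg_itv v d.
  have p0 := pi_gt0 R.
  have nc (a : R) : pi / 2 <= a < pi -> cos a <= 0.
    move=> /andP[a1 a2]; rewrite -[a](subrK pi) cosDpi oppr_le0.
    by rewrite cos_ge0_pihalf//; lra.
  apply/andP; split; rewrite ltNge; apply/negP => hh; move: c0; rewrite ltNge => /negP; apply.
    by rewrite -cosN; apply: nc; lra.
  by apply: nc; lra.
have s1 := small _ xd; have s2 := small _ yd.
rewrite !subr_eq0 in s1 s2; move: (s1 n1) (s2 n2) => {}s1 {}s2.
have i3 := arg_itv (x - z) (y - z).
(* The sum of the three angles has cosine 1, and the bounds by pi / 2 keep it below [2 * pi] in
   absolute value. *)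
suff : arg (x - z) (y - z) + (arg (y - z) d + arg d (x - z)) = 0 by rewrite (argC _ d); lra.
apply: cos_eq1_small; last by rewrite (argC _ d) ltr_norml; lra.
have nz : ~ segment x y z by move=> /xy; exact.
have wd := arg_wd nz.
have v0 : 0 < enorm (y - z) by rewrite enorm_gt0 subr_eq0.
have u0 : 0 < enorm (x - z) by rewrite enorm_gt0 subr_eq0.
have dd0 : 0 < enorm d by rewrite enorm_gt0.
have w2 : 0 < enorm (y - z) * enorm d + dotp (y - z) d by rewrite addr_gt0// mulr_gt0.
have w3 : 0 < enorm d * enorm (x - z) + dotp d (x - z) by rewrite dotpC addr_gt0// mulr_gt0.
apply: (mulfI (lt0r_neq0 (mulr_gt0 u0 u0))); rewrite mulr1 -[RHS]expr2 enorm_sqr.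
by apply: (arg_add_cos v0); rewrite ?arg_cos ?arg_sin//;
  [apply: (arg_add_cos dd0)|apply: (arg_add_sin dd0)]; rewrite ?arg_cos ?arg_sin.
Qed.

(** The winding number is constant on [U]; from a point of [U] far enough out all vertices lie in
    the half-plane towards the origin, where the sum telescopes to 0. *)
Lemma wsum_unbounded (U : set (plane R)) x s : connected U -> ~ bounded_set U ->
  last x s = x -> chain (~` U) x s -> forall z, U z -> wsum z x s = 0.
Proof.
case: s => [//|y s] cU nbU lx ch.
have chz z : U z -> chain (~` [set z]) x (y :: s).
  by move=> Uz; apply: sub_chain ch; apply: subsetC => _ ->.
have xU z : U z -> x != z.
  by move=> Uz; apply/eqP => xz; case: ch => /(_ x (segment_l x y)); rewrite xz.
pose M := \sum_(w <- x :: y :: s) `|w|.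
have [z0 Uz0 Mz0] := unboundedP nbU (2 * M).
have far w : w \in x :: y :: s -> 0 < dotp (w - z0) (- z0).
  move=> ws; apply: far_half_plane; apply: le_lt_trans Mz0.
  rewrite ler_pM2l// /M (big_rem w)//= lerDl.
  by apply: sumr_ge0.
apply: (@cos_eq1_connected U _ z0) => //.
- by move=> z Uz; exact/wsum_cont/chz.
- move=> z Uz; have [+ _] := wsum_cos_sin (xU z Uz) (chz z Uz).
  rewrite lx -expr2 -enorm_sqr -[RHS]mulr1; apply: mulfI.
  by rewrite sqrf_eq0 gt_eqF// enorm_gt0 subr_eq0 xU.
- rewrite (@wsum_half_plane _ (- z0)); last exact: chz.
  + by rewrite lx subrr.
  + by apply: far; rewrite mem_head.
  + by move=> w ws; apply: far; rewrite in_cons ws orbT.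
Qed.

End Winding.

(** * Separation by chords *)

Section Crossing.
Context {R : realType}.
Implicit Types x y z u w d p q a b c : plane R.
Implicit Types A B C P U K : set (plane R).

Lemma arg_wd_cross u w : crossp u w != 0 -> 0 < enorm u * enorm w + dotp u w.
Proof.
move=> c0; have h := lagrange_id u w; rewrite -!enorm_sqr -exprMn in h.
have : `|dotp u w| < enorm u * enorm w.
  rewrite -ltr_sqr ?nnegrE ?mulr_ge0 ?enorm_ge0// real_normK ?num_real// -h.
  by rewrite ltrDl lt_neqAle eq_sym sqrf_eq0 c0 sqr_ge0.
by rewrite ltr_norml => /andP[]; lra.
Qed.

Lemma enormZ (k : R) u : 0 <= k -> enorm (k *: u) = k * enorm u.
Proof.
move=> k0; rewrite /enorm.
have -> : dotp (k *: u) (k *: u) = k ^+ 2 * dotp u u by rewrite /dotp !coordE; ring.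
by rewrite sqrtrM ?sqr_ge0// sqrtr_sqr ger0_norm.
Qed.

Lemma argZr (k : R) u w : 0 < k -> arg u (k *: w) = arg u w.
Proof.
move=> k0; rewrite /arg enormZ ?ltW//.
have -> : crossp u (k *: w) = k * crossp u w by rewrite /crossp !coordE; ring.
have -> : enorm u * (k * enorm w) + dotp u (k *: w) = k * (enorm u * enorm w + dotp u w).
  by rewrite /dotp !coordE; ring.
by rewrite -mulf_div divff ?mul1r// gt_eqF.
Qed.

Lemma argZl (k : R) u w : 0 < k -> arg (k *: u) w = arg u w.
Proof. by move=> k0; rewrite argC argZr// -argC. Qed.

Lemma arg_same u : arg u u = 0.
Proof. by rewrite /arg (_ : crossp u u = 0) ?mul0r ?atan0 ?mulr0// /crossp; ring. Qed.

Lemma segmentC x y : segment x y = segment y x.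
Proof.
apply/seteqP; split=> z /segmentP[t t01 ->]; apply/segmentP; exists (1 - t); [lra| |lra|];
  by apply: plane_eq; rewrite !coordE; ring.
Qed.

Lemma line_cont (p d : plane R) : continuous (fun t : R => p + t *: d).
Proof. by move=> t; apply: cvgD; [exact: cvg_cst|apply: cvgZr_tmp; exact: cvg_id]. Qed.

Lemma seg_param_cont x y : continuous (fun t : R => (1 - t) *: x + t *: y).
Proof.
move=> t; apply: cvgD; apply: cvgZr_tmp; last exact: cvg_id.
by apply: cvgB; [exact: cvg_cst|exact: cvg_id].
Qed.

Lemma connected_segment x y : connected (segment x y).
Proof.
apply: connected_continuous_connected; first exact: segment_connected.
by apply: continuous_subspaceT => t; exact: seg_param_cont.
Qed.

Lemma compact_segment x y : compact (segment x y).
Proof.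
apply: continuous_compact; last exact: segment_compact.
by apply: continuous_subspaceT => t; exact: seg_param_cont.
Qed.

Lemma closed_segment x y : closed (segment x y).
Proof. by apply: compact_closed; [exact: norm_hausdorff|exact: compact_segment]. Qed.

(* The winding numbers around [z] and [z'] of the closed polygonal path from [a] to
   [b], then through [q] and [p] back to [a], are both [0]. Moving from [z'] to
   [z] along the line, which the path from [a] to [b] misses, changes
   [arg (b - z) d + arg d (a - z)] continuously; but the last part of the path is
   seen in direction [d] from [z'] and in direction [- d] from [z], so the angles
   have opposite signs. *)
Lemma crossing_winding (z z' a b p q : plane R) s (U U' : set (plane R)) (mu nu : R) :
  let d := z - z' in
  last a s = b -> 0 < crossp d (a - z) -> crossp d (b - z) < 0 ->
  0 < mu < 1 -> p = z' + mu *: d -> 0 < nu < 1 -> q = z' + nu *: d ->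
  chain (~` segment z' z) a s ->
  connected U -> ~ bounded_set U -> U z -> chain (~` U) a (s ++ [:: q; p; a]) ->
  connected U' -> ~ bounded_set U' -> U' z' -> chain (~` U') a (s ++ [:: q; p; a]) ->
  False.
Proof.
move=> d lb ad bd mu01 pE nu01 qE chs cU bU Uz chU cU' bU' Uz' chU'.
have side w c : segment z' z w -> crossp d (c - w) = crossp d (c - z).
  move=> /segmentP[t _ ->].
  by rewrite /crossp /d !coordE; ring.
have ca w : segment z' z w -> 0 < crossp d (a - w) by move=> /side ->.
have cb w : segment z' z w -> crossp d (b - w) < 0 by move=> /side ->.
have wda w : segment z' z w -> 0 < enorm d * enorm (a - w) + dotp d (a - w).
  by move=> h; apply: arg_wd_cross; rewrite gt_eqF// ca.
have wdb w : segment z' z w -> 0 < enorm (b - w) * enorm d + dotp (b - w) d.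
  by move=> h; apply: arg_wd_cross; rewrite crosspC gt_eqF// oppr_gt0 cb.
(* [D] closes the path through the fixed direction [d] in place of [q] and [p], so it stays
   continuous while [w] passes these two points. *)
pose D w := wsum w a s + (arg (b - w) d + arg d (a - w)).
have d0 : 0 < enorm d.
  rewrite enorm_gt0; apply/eqP => e; move: ad; rewrite e /crossp /=.
  by rewrite !mul0r subrr ltxx.
have aw w : segment z' z w -> a != w.
  move=> h; apply/eqP => e; have := ca _ h; rewrite e subrr /crossp /=.
  by rewrite !mulr0 subrr ltxx.
have bw w : segment z' z w -> b != w.
  move=> h; apply/eqP => e; have := cb _ h; rewrite e subrr /crossp /=.
  by rewrite !mulr0 subrr ltxx.
have chw w : segment z' z w -> chain (~` [set w]) a s.
  by move=> h; apply: sub_chain chs; apply: subsetC => _ ->.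
have wE w : wsum w a (s ++ [:: q; p; a]) =
    wsum w a s + (arg (b - w) (q - w) + (arg (q - w) (p - w) + arg (p - w) (a - w))).
  by rewrite wsum_cat lb /= addr0.
have Sz' : segment z' z z' := segment_l z' z.
have Sz : segment z' z z := segment_r z' z.
have lp w : last a (s ++ [:: q; p; a]) = a by rewrite last_cat.
have W0 := wsum_unbounded cU bU (lp z) chU Uz.
have W0' := wsum_unbounded cU' bU' (lp z) chU' Uz'.
have Dz' : D z' = 0.
  rewrite wE in W0'.
  rewrite -W0' /D; congr (_ + _).
  have -> : q - z' = nu *: d by rewrite qE addrC addKr.
  have -> : p - z' = mu *: d by rewrite pE addrC addKr.
  by rewrite !argZr ?argZl ?arg_same ?add0r//; lra.
have Dz : D z = 0.
  apply: (@cos_eq1_connected _ (segment z' z) D z') => //.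
  - exact: connected_segment.
  - move=> w Sw; apply: (@continuousD _ _ _ (fun w => wsum w a s)).
      exact/wsum_cont/chw.
    apply: (@continuousD _ _ _ (fun w => arg (b - w) d)).
      by apply: arg_cont; [exact: sub_cont|exact: cvg_cst|exact: wdb].
    by apply: arg_cont; [exact: cvg_cst|exact: sub_cont|exact: wda].
  - move=> w Sw.
    have [c1 s1] := wsum_cos_sin (aw _ Sw) (chw _ Sw).
    rewrite lb in c1 s1.
    have b0 : 0 < enorm (b - w) by rewrite enorm_gt0 subr_eq0 bw.
    have a0 : 0 < enorm (a - w) by rewrite enorm_gt0 subr_eq0 aw.
    apply: (mulfI (lt0r_neq0 (mulr_gt0 a0 a0))); rewrite mulr1 -[RHS]expr2 enorm_sqr.
    have [w1 w2] := (wda _ Sw, wdb _ Sw).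
    by apply: (arg_add_cos b0 c1 s1);
      [apply: (arg_add_cos d0)|apply: (arg_add_sin d0)]; rewrite ?arg_cos ?arg_sin.
have Sd : wsum z a s + (arg (b - z) (- d) + arg (- d) (a - z)) = 0.
  rewrite wE in W0.
  rewrite -W0; congr (_ + _).
  have -> : q - z = (1 - nu) *: (- d).
    by rewrite qE /d; apply: plane_eq; rewrite !coordE; ring.
  have -> : p - z = (1 - mu) *: (- d).
    by rewrite pE /d; apply: plane_eq; rewrite !coordE; ring.
  by rewrite !argZr ?argZl ?arg_same ?add0r//; lra.
have cN v : crossp (- d) v = - crossp d v by rewrite /crossp !coordE; ring.
have l1 : 0 < arg d (a - z) by apply: arg_gt0; [exact: wda|exact: ca].
have l2 : 0 < arg (b - z) d by apply: arg_gt0; [exact: wdb|rewrite crosspC oppr_gt0; exact: cb].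
have l3 : arg (- d) (a - z) < 0.
  by apply: arg_lt0; [apply: arg_wd_cross; rewrite cN oppr_eq0 gt_eqF|rewrite cN oppr_lt0].
have l4 : arg (b - z) (- d) < 0.
  by apply: arg_lt0; [apply: arg_wd_cross|]; rewrite crosspC cN opprK ?lt_eqF.
move: Dz Sd; rewrite /D; lra.
Qed.

Definition linked A x y := exists2 s, chain A x s & last x s = y.

Lemma linked_refl A x : linked A x x.
Proof. by exists [::]. Qed.

Lemma linked_seg A x y : segment x y `<=` A -> linked A x y.
Proof. by move=> h; exists [:: y]. Qed.

Lemma linked_trans A y x z : linked A x y -> linked A y z -> linked A x z.
Proof.
move=> [s hs ls] [s' hs' ls']; exists (s ++ s'); last by rewrite last_cat ls.
by apply/chain_cat; rewrite ls.
Qed.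

Lemma linked_sym A x y : linked A x y -> linked A y x.
Proof.
move=> [s hs <-]; elim: s x hs => [|y' s IH] x /=; first by move=> _; exact: linked_refl.
move=> [h /IH l]; apply: linked_trans l _.
by apply: linked_seg; rewrite segmentC.
Qed.

Lemma sub_linked A B x y : A `<=` B -> linked A x y -> linked B x y.
Proof. by move=> AB [s h l]; exists s => //; exact: sub_chain h. Qed.

Lemma linked_mem A x y : A x -> linked A x y -> A y.
Proof.
move=> Ax [s + <-]; elim: s x Ax => [|z s IH] x Ax //= [h /IH]; apply.
exact/h/segment_r.
Qed.

Lemma near_segment x A : nbhs x A -> \forall y \near x, segment x y `<=` A.
Proof.
move=> /nbhs_ballP[e /= e0 eA]; near=> y.
have : ball x e y by near: y; exact: nbhsx_ballx.
rewrite -ball_normE /= => xy z /segmentP[t /andP[t0 t1] ->].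
apply: eA; rewrite -ball_normE /=.
have -> : x - ((1 - t) *: x + t *: y) = t *: (x - y).
  by apply: plane_eq; rewrite !coordE; ring.
rewrite normrZ ger0_norm//; apply: le_lt_trans xy.
by rewrite ler_piMl.
Unshelve. all: by end_near. Qed.

(** Polygons satisfy this at their boundary points too; it makes being linked an open relation
    inside [A]. *)
Definition locally_starshaped A :=
  forall x, A x -> \forall y \near x, A y -> segment x y `<=` A.

Lemma locally_starshapedD A C : locally_starshaped A -> closed C ->
  locally_starshaped (A `\` C).
Proof.
move=> lA cC x [Ax Cx].
have /near_segment h : nbhs x (~` C) by apply: open_nbhs_nbhs; split => //; exact: closed_openC.
near=> y => -[Ay _] z xyz; split.
  have /(_ Ay) : A y -> segment x y `<=` A by near: y; exact: lA.
  exact.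
have : segment x y `<=` ~` C by near: y.
exact.
Unshelve. all: by end_near. Qed.

Lemma near_linked A x y : locally_starshaped A -> A y -> linked A x y ->
  \forall z \near y, A z -> linked A x z.
Proof.
move=> lA Ay xy; near=> z; move=> Az; apply: linked_trans xy _; apply: linked_seg.
by move: Az; near: z; exact: lA.
Unshelve. all: by end_near. Qed.

Lemma near_unlinked A x y : locally_starshaped A -> A y -> ~ linked A x y ->
  \forall z \near y, A z -> ~ linked A x z.
Proof.
move=> lA Ay xy; near=> z; move=> Az xz; apply: xy; apply: linked_trans xz _; apply: linked_sym.
by apply: linked_seg; move: Az; near: z; exact: lA.
Unshelve. all: by end_near. Qed.

(** The points linked to [x] and those not linked to it are both open relative to [A], so a
    connected subset cannot meet both. *)
Lemma connected_linked A X x y : locally_starshaped A -> connected X -> X `<=` A ->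
  X x -> X y -> linked A x y.
Proof.
move=> lA cX XA Xx Xy; pose B := X `&` linked A x.
suff BX : B = X by have [] : B y by rewrite BX.
apply: (cX B).
- by exists x; split=> //; exact: linked_refl.
-
  exists (interior [set w | A w -> linked A x w]); first exact: open_interior.
  apply/seteqP; split => z [Xz h]; split=> //.
    by apply: near_linked => //; exact: XA.
  by apply: (nbhs_singleton h); exact: XA.
- exists (~` interior [set w | A w -> ~ linked A x w]).
  by apply: open_closedC; exact: open_interior.
apply/seteqP; split => z [Xz h]; split=> //.
  by move=> /nbhs_singleton; apply=> //; exact: XA.
by apply: contrapT => nl; apply: h; apply: near_unlinked => //; exact: XA.
Qed.

Fixpoint trail x (s : seq (plane R)) : set (plane R) :=
  if s is y :: s' then segment x y `|` trail y s' else set0.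

Lemma closed_trail x s : closed (trail x s).
Proof.
elim: s x => [|y s IH] x /=; first exact: closed0.
by apply: closedU => //; exact: closed_segment.
Qed.

Lemma trailP A x s : chain A x s <-> trail x s `<=` A.
Proof.
elim: s x => [|y s IH] x /=; first by split=> // _ ? [].
by rewrite IH subUset.
Qed.

(** [tau] is the first exit time. The ray may return to [P] afterwards, so outside points are only
    claimed arbitrarily soon after [tau]. *)
Lemma exit_param P p d : closed P -> bounded_set P -> P p -> d != 0 ->
  exists2 tau : R, 0 <= tau /\ (forall s, 0 <= s <= tau -> P (p + s *: d)) &
    forall e, 0 < e -> exists2 s, tau < s < tau + e & ~ P (p + s *: d).
Proof.
move=> cP bP Pp d0.
pose T : set R := [set t | 0 <= t /\ forall s, 0 <= s <= t -> P (p + s *: d)].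
have T0 : T 0.
  split=> // s; rewrite -eq_le => /eqP <-; by rewrite scale0r addr0.
have [M [_ PM]] := bP.
have dn : 0 < `|d| by rewrite normr_gt0.
pose L := (`|M| + 1 + `|p|) / `|d|.
have TL : ubound T L.
  move=> t [t0 /(_ t)]; rewrite t0 lexx => /(_ isT) /PM h.
  have /h /= : M < `|M| + 1 by rewrite (le_lt_trans (ler_norm _))// ltrDl.
  rewrite /L ler_pdivlMr// => h2.
  have -> : t * `|d| = `|(p + t *: d) - p| by rewrite addrC addKr normrZ ger0_norm.
  by apply: le_trans (ler_normB _ _) _; rewrite lerD2r.
have sT : has_sup T by split; [exists 0|exists L].
have tau0 : 0 <= sup T by apply: ub_le_sup => //; exists L.
have below s : 0 <= s < sup T -> P (p + s *: d).
  move=> /andP[s0 sT1]; have e0 : 0 < sup T - s by rewrite subr_gt0.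
  have [t [t0 Tt] st] := sup_adherent e0 sT.
  by apply: Tt; rewrite s0 ltW//; move: st; rewrite opprB addrC subrK.
have Ptau : P (p + sup T *: d).
  have [->|tn0] := eqVneq (sup T) 0; first by rewrite scale0r addr0.
  have tp : 0 < sup T by rewrite lt_neqAle eq_sym tn0.
  have : closed ((fun t : R => p + t *: d) @^-1` P).
    by apply: preimage_closed => // t _; exact: line_cont.
  apply => B /nbhs_ballP[e /= e0 eB].
  pose s := Num.max (sup T / 2) (sup T - e / 2).
  exists s; split.
    by apply: below; rewrite /s le_max gt_max; lra.
  apply: eB; rewrite -ball_normE /= ger0_norm /s; first by rewrite ltrBlDr -ltrBlDl lt_max; lra.
  by rewrite subr_ge0 ge_max; lra.
exists (sup T).
  split=> // s /andP[s0]; rewrite le_eqVlt => /orP[/eqP ->//|sT1].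
  by apply: below; rewrite s0.
move=> e e0; apply: contrapT => h.
have : T (sup T + e / 2).
  split; first by lra.
  move=> s /andP[s0 se]; have [sT1|sT1] := leP s (sup T).
    by move: sT1; rewrite le_eqVlt => /orP[/eqP ->//|?]; apply: below; rewrite s0.
  by apply: contrapT => nP; apply: h; exists s => //; lra.
move=> /(ub_le_sup (ex_intro _ L TL)); lra.
Qed.

(** Absence of holes, in the form that makes winding numbers around outside points vanish. *)
Definition filled P := forall z, ~ P z ->
  exists U : set (plane R), [/\ connected U, ~ bounded_set U, U z & U `<=` ~` P].

Definition chord P p d : set (plane R) :=
  [set x | (exists t : R, x = p + t *: d) /\ segment p x `<=` P].

Lemma chord_separates P p d a b c1 c2 : closed P -> bounded_set P -> filled P ->
  P p -> d != 0 ->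
  chord P p d c1 -> 0 < crossp d (a - p) -> segment c1 a `<=` P ->
  chord P p d c2 -> crossp d (b - p) < 0 -> segment c2 b `<=` P ->
  ~ linked (P `\` chord P p d) a b.
Proof.
move=> cP bP fP Pp d0 [[t1 c1E] Pc1] ad c1a [[t2 c2E] Pc2] bd c2b [s chs lb].
have nd0 : - d != 0 by rewrite oppr_eq0.
have [tau [tau0 tauP] tauE] := exit_param cP bP Pp d0.
have [sig [sig0 sigP] sigE] := exit_param cP bP Pp nd0.
have inC t : - sig <= t <= tau -> P (p + t *: d).
  move=> /andP[h1 h2]; have [t0|t0] := leP 0 t; first by apply: tauP; rewrite t0.
  have -> : p + t *: d = p + (- t) *: (- d) by rewrite scalerN scaleNr opprK.
  by apply: sigP; lra.
have chC t : - sig <= t <= tau -> chord P p d (p + t *: d).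
  move=> h; split; first by exists t.
  move=> x /segmentP[l /andP[l0 l1] ->].
  have -> : (1 - l) *: p + l *: (p + t *: d) = p + (l * t) *: d.
    by apply: plane_eq; rewrite !coordE; ring.
  apply: inC; nra.
have bound t x : x = p + t *: d -> segment p x `<=` P -> - sig <= t <= tau.
  move=> -> h.
  have h' l : 0 <= l <= 1 -> P (p + (l * t) *: d).
    move=> l01; have -> : p + (l * t) *: d = (1 - l) *: p + l *: (p + t *: d).
      by apply: plane_eq; rewrite !coordE; ring.
    by apply: h; apply/segmentP; exists l.
  apply/andP; split; rewrite leNgt; apply/negP => ht.
    have e0 : 0 < - sig - t by lra.
    have [s' hs' ns'] := sigE _ e0.
    have tn : t != 0 by rewrite lt_eqF//; lra.
    apply: ns'; have -> : p + s' *: (- d) = p + ((- s' / t) * t) *: d.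
      by rewrite divfK// scalerN scaleNr.
    apply: h'; rewrite mulNr -mulrN -invrN.
    by rewrite divr_ge0 ?ler_pdivrMr ?mul1r//; lra.
  have e0 : 0 < t - tau by lra.
  have [s' hs' ns'] := tauE _ e0.
  have tn : t != 0 by rewrite gt_eqF//; lra.
  apply: ns'; have -> : p + s' *: d = p + ((s' / t) * t) *: d by rewrite divfK.
  apply: h'.
  by rewrite divr_ge0 ?ler_pdivrMr ?mul1r//; lra.
have b1 := bound _ _ c1E Pc1; have b2 := bound _ _ c2E Pc2.
have trPC : trail a s `<=` P `\` chord P p d by apply/trailP.
(* The trail is closed and misses the chord, so it also misses the line a little beyond both ends,
   where points outside [P] are available. *)
have clr r : - sig <= r <= tau ->
    exists2 e : R, 0 < e & forall t, `|r - t| < e -> ~ trail a s (p + t *: d).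
  move=> hr.
  have : nbhs r ((fun t : R => p + t *: d) @^-1` (~` trail a s)).
    apply: (line_cont (p := p) (d := d)); apply: open_nbhs_nbhs; split.
      by apply: closed_openC; exact: closed_trail.
    by move=> /trPC [_]; apply; exact: chC.
  by move=> /nbhs_ballP[e /= e0 he]; exists e => // t ht; apply: he; rewrite -ball_normE.
have [e1 e10 he1] : exists2 e : R, 0 < e & forall t, `|tau - t| < e -> ~ trail a s (p + t *: d).
  by apply: clr; lra.
have [e2 e20 he2] : exists2 e : R, 0 < e & forall t, `|- sig - t| < e -> ~ trail a s (p + t *: d).
  by apply: clr; lra.
have [r1 hr1 nr1] := tauE _ e10.
have [r2 hr2 nr2] := sigE _ e20.
have [U [cU bU Uz UP]] := fP _ nr1.
have [U' [cU' bU' Uz' UP']] := fP _ nr2.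
have Dn : 0 < r1 + r2 by lra.
have dE : p + r1 *: d - (p + r2 *: - d) = (r1 + r2) *: d.
  by apply: plane_eq; rewrite !coordE; ring.
have loopP : chain P a (s ++ [:: c2; c1; a]).
  apply/chain_cat; split; first by apply: sub_chain chs; exact: subIsetl.
  rewrite lb /=; split; first by rewrite segmentC.
  split; last by split.
  move=> x /segmentP[l /andP[l0 l1] ->]; rewrite c1E c2E.
  have -> : (1 - l) *: (p + t2 *: d) + l *: (p + t1 *: d) = p + ((1 - l) * t2 + l * t1) *: d.
    by apply: plane_eq; rewrite !coordE; ring.
  apply: inC; move: b1 b2 => /andP[? ?] /andP[? ?]; nra.
(* The two quotients are the positions of [c1] and [c2] on the segment between the chosen outside
   points. *)
apply: (@crossing_winding (p + r1 *: d) (p + r2 *: (- d)) a b c1 c2 s U U'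
   ((r2 + t1) / (r1 + r2)) ((r2 + t2) / (r1 + r2))) => //.
- rewrite dE; have -> : crossp ((r1 + r2) *: d) (a - (p + r1 *: d)) = (r1 + r2) * crossp d (a - p).
    by rewrite /crossp !coordE; ring.
  exact: mulr_gt0.
- rewrite dE; have -> : crossp ((r1 + r2) *: d) (b - (p + r1 *: d)) = (r1 + r2) * crossp d (b - p).
    by rewrite /crossp !coordE; ring.
  by rewrite pmulr_rlt0.
- by rewrite divr_gt0 ?ltr_pdivrMr ?mul1r//; lra.
- rewrite dE scalerA divfK ?gt_eqF// c1E.
  by apply: plane_eq; rewrite !coordE; ring.
- by rewrite divr_gt0 ?ltr_pdivrMr ?mul1r//; lra.
- rewrite dE scalerA divfK ?gt_eqF// c2E.
  by apply: plane_eq; rewrite !coordE; ring.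
- apply/trailP => x tx /segmentP[l /andP[l0 l1] xE].
  have {}xE : x = p + (l * (r1 + r2) - r2) *: d.
    by rewrite xE; apply: plane_eq; rewrite !coordE; ring.
  have : - r2 <= l * (r1 + r2) - r2 <= r1 by nra.
  move: xE; set t := (_ - r2) => xE /andP[tr2 tr1].
  have [tt|tt] := ltP tau t.
    by apply: (he1 t); [rewrite ltr_norml; lra|rewrite -xE].
  have [ts|ts] := ltP t (- sig).
    by apply: (he2 t); [rewrite ltr_norml; lra|rewrite -xE].
  by have [_] := trPC _ tx; apply; rewrite xE; apply: chC; lra.
- by apply: sub_chain loopP => x Px /UP.
- by apply: sub_chain loopP => x Px /UP'.
Qed.

End Crossing.

(** * Polygon regions *)

Section PolygonTopology.
Context {R : realType} {n : nat} (v : 'I_n -> plane R).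
Implicit Types x y z u w d p q a b c : plane R.
Implicit Types A C U : set (plane R).

Local Notation curve := (polygonal_curve v).
Local Notation P := (polygon_region v).

Lemma edge_sub_curve i : segment (v i) (v (ordS i)) `<=` curve.
Proof. by move=> x h; exists i. Qed.

Lemma curve_sub_region : curve `<=` P.
Proof. by move=> x; left. Qed.

Lemma edge_sub_region i : segment (v i) (v (ordS i)) `<=` P.
Proof. by apply: subset_trans curve_sub_region; exact: edge_sub_curve. Qed.

Lemma closed_curve : closed curve.
Proof. by apply: closed_bigcup => [|i _]; [exact: finite_finset|exact: closed_segment]. Qed.

Lemma norm_segment_le x y z : segment x y z -> `|z| <= `|x| + `|y|.
Proof.
move=> /segmentP[t /andP[t0 t1] ->]; apply: le_trans (ler_normD _ _) _.
rewrite !normrZ !ger0_norm//; last by lra.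
by apply: lerD; rewrite ler_piMl//; lra.
Qed.

Let M : R := \sum_i (`|v i| + `|v (ordS i)|).

Lemma curve_bound x : curve x -> `|x| <= M.
Proof.
move=> [i _ /norm_segment_le h]; apply: le_trans h _.
by rewrite /M (bigD1 i)//= lerDl sumr_ge0// => j _; rewrite addr_ge0.
Qed.

Lemma region_component x y : P x -> ~ curve x -> connected_component (~` curve) x y -> P y.
Proof.
move=> [//|[nx bx]] _ xy; right; split; first exact: connected_component_sub xy.
by rewrite -(same_connected_component xy).
Qed.

Lemma region_connected A x y : connected A -> A `<=` ~` curve -> A x -> A y -> P x -> P y.
Proof.
move=> cA Ac Ax Ay Px; apply: (region_component Px); first exact: Ac.
by exists A.
Qed.

Lemma near_not_curve x : ~ curve x -> \forall y \near x, segment x y `<=` ~` curve.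
Proof.
move=> nx; apply: near_segment; apply: open_nbhs_nbhs; split=> //.
exact/closed_openC/closed_curve.
Qed.

Lemma near_region x : P x -> ~ curve x -> \forall y \near x, P y.
Proof.
move=> Px nx; near=> y; apply: (@region_connected (segment x y) x) => //.
- exact: connected_segment.
- by near: y; exact: near_not_curve.
- exact: segment_l.
- exact: segment_r.
Unshelve. all: by end_near. Qed.

Lemma closed_region : closed P.
Proof.
rewrite -openC openE => x nPx.
have nx : ~ curve x by move=> /curve_sub_region.
rewrite /interior; near=> y; move=> Py; apply: nPx.
have xy : segment x y `<=` ~` curve by near: y; exact: near_not_curve.
by apply: (region_connected _ xy (segment_r x y) (segment_l x y)) => //; exact: connected_segment.
Unshelve. all: by end_near. Qed.

Lemma region_bound x : P x -> `|x| <= M.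
Proof.
move=> [|[nx bx]]; first exact: curve_bound.
rewrite leNgt; apply/negP => Mx.
have M0 : 0 <= M by apply: sumr_ge0 => j _; rewrite addr_ge0.
have x0 : 0 < `|x| by apply: le_lt_trans Mx.
(* Beyond the bound [M] the outward ray misses the curve, so the component of [x] would be
   unbounded. *)
have xray (t : R) : 1 <= t -> connected_component (~` curve) x (t *: x).
  move=> t1; exists (segment x (t *: x)); last exact: segment_r.
  split; [exact: segment_l| |exact: connected_segment].
  move=> z /segmentP[l /andP[l0 l1] zE] /curve_bound.
  have -> : z = (1 + l * (t - 1)) *: x by rewrite zE; apply: plane_eq; rewrite !coordE; ring.
  have l2 : 0 <= l * (t - 1) by rewrite mulr_ge0// subr_ge0.
  rewrite normrZ ger0_norm; last by lra.
  have : `|x| <= (1 + l * (t - 1)) * `|x| by rewrite ler_peMl// lerDl.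
  lra.
have [N [_ hN]] := bx.
have N1 : N < `|N| + 1 by rewrite (le_lt_trans (ler_norm _))// ltrDl.
pose t := 1 + (`|N| + 1) / `|x|.
have t1 : 1 <= t by rewrite lerDl divr_ge0// addr_ge0.
have /= := hN _ N1 _ (xray t t1).
rewrite normrZ ger0_norm ?(le_trans _ t1)// mulrDl divfK ?gt_eqF// mul1r; lra.
Qed.

Lemma bounded_region : bounded_set P.
Proof.
exists M; split; first exact: num_real.
by move=> N MN x /region_bound /le_trans; apply; exact: ltW.
Qed.

Lemma compact_region : compact P.
Proof.
apply: (@subclosed_compact _ _ (`[- M, M]%classic `*` `[- M, M]%classic)).
- exact: closed_region.
- by apply: (@compact_setX R R); exact: segment_compact.
- move=> x /region_bound h; have h1 := norm_fst_le x; have h2 := norm_snd_le x.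
  by split; rewrite /= in_itv /= -ler_norml; [apply: le_trans h1 h|apply: le_trans h2 h].
Qed.

Lemma filled_region : filled P.
Proof.
move=> z nz; exists (connected_component (~` curve) z).
have nc : ~ curve z by move=> /curve_sub_region.
split; first exact: component_connected.
- by move=> bd; apply: nz; right.
- exact: connected_component_refl.
- move=> y zy Py; apply: nz; apply: (region_component Py).
    exact: connected_component_sub zy.
  exact: connected_component_sym.
Qed.

(** [al + (ze - al) / s] is the coordinate of [y] along the line from [A] to [B]. A value beyond 1
    would put [B] on the segment from [x] to [y]; and if [B = x], then [ze <= 1] already bounds
    it. *)
Lemma segment_ray_end (A B x y : plane R) (al ze s : R) : A != B ->
  B = x \/ ~ segment x y B ->
  0 <= al <= 1 -> 0 <= ze <= 1 -> 0 < s <= 1 ->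
  x = A + al *: (B - A) -> x + s *: (y - x) = A + ze *: (B - A) ->
  al + (ze - al) / s <= 1.
Proof.
move=> AB hB /andP[al0 al1] /andP[ze0 ze1] /andP[s0 s1] xE zE.
have sn : s != 0 by rewrite gt_eqF.
have yE : y - x = ((ze - al) / s) *: (B - A).
  have : s *: (y - x) = (ze - al) *: (B - A).
    transitivity (A + ze *: (B - A) - (A + al *: (B - A))).
      by rewrite -zE -xE addrAC subrr add0r.
    by apply: plane_eq; rewrite !coordE; ring.
  by move=> e; apply: (scalerI sn); rewrite e scalerA mulrC divfK.
rewrite leNgt; apply/negP => h.
have h0 : 0 < (ze - al) / s by lra.
case: hB => [Bx|].
  have al1' : al = 1.
    have : (1 - al) *: (B - A) = 0.
      transitivity (B - (A + al *: (B - A))); last by rewrite -xE Bx subrr.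
      by apply: plane_eq; rewrite !coordE; ring.
    by move/eqP; rewrite scaler_eq0 !subr_eq0 [B == A]eq_sym (negbTE AB) orbF => /eqP ->.
  have : (ze - al) / s <= 0 by rewrite ler_pdivrMr// mul0r; lra.
  lra.
apply; apply/segmentP; exists ((1 - al) / ((ze - al) / s)).
  rewrite divr_ge0 ?ler_pdivrMr//=; lra.
transitivity (x + ((1 - al) / ((ze - al) / s)) *: (y - x)); last first.
  by apply: plane_eq; rewrite !coordE; ring.
rewrite yE scalerA divfK ?gt_eqF// xE.
by apply: plane_eq; rewrite !coordE; ring.
Qed.

(** A second common point puts the segment from [x] to [y] on the line of [A] and [B], and a [y]
    close to [x] does not run past an end; [segment_ray_end] is applied to each end in turn. *)
Lemma near_segment_cone (A B x : plane R) : \forall y \near x, forall z, segment x y z -> z != x ->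
  segment A B z -> segment A B x /\ segment A B y.
Proof.
have [xAB|xAB] := pselect (segment A B x); last first.
  have /near_segment h : nbhs x (~` segment A B).
    by apply: open_nbhs_nbhs; split=> //; exact/closed_openC/closed_segment.
  near=> y; move=> z xyz _ ABz; exfalso.
  have : segment x y `<=` ~` segment A B by near: y.
  by move=> /(_ _ xyz).
have avoid w : \forall y \near x, w = x \/ ~ segment x y w.
  have [wx|wx] := eqVneq w x; first by near=> y; left.
  have /near_segment h : nbhs x (~` [set w]).
    apply: open_nbhs_nbhs; split; last by move/eqP; rewrite eq_sym (negbTE wx).
    apply/closed_openC; apply: compact_closed; first exact: norm_hausdorff.
    exact: compact_set1.
  near=> y; right; have : segment x y `<=` ~` [set w] by near: y.
  by move=> h' /h'; apply.
near=> y.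
have hA : A = x \/ ~ segment x y A by near: y; exact: avoid.
have hB : B = x \/ ~ segment x y B by near: y; exact: avoid.
move=> z xyz zx ABz; split=> //.
have AB : A != B.
  apply: contraNneq zx => AB; move: xAB ABz; rewrite AB => /segmentP[t _ ->] /segmentP[t' _ ->].
  by rewrite -!scalerDl !subrK.
have /segmentP[al al01 xE] := xAB.
have /segmentP[ze ze01 zE] := ABz.
have /segmentP[s /andP[s0 s1] sE] := xyz.
have sp : 0 < s.
  rewrite lt_neqAle s0 andbT eq_sym; apply: contraNneq zx => s00.
  by rewrite sE s00 subr0 scale1r scale0r addr0.
have sn : s != 0 by rewrite gt_eqF.
have xE1 : x = A + al *: (B - A) by rewrite xE; apply: plane_eq; rewrite !coordE; ring.
have xE2 : x = B + (1 - al) *: (A - B) by rewrite xE; apply: plane_eq; rewrite !coordE; ring.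
have sE' : x + s *: (y - x) = z by rewrite sE; apply: plane_eq; rewrite !coordE; ring.
have zE1 : x + s *: (y - x) = A + ze *: (B - A).
  by rewrite sE' zE; apply: plane_eq; rewrite !coordE; ring.
have zE2 : x + s *: (y - x) = B + (1 - ze) *: (A - B).
  by rewrite sE' zE; apply: plane_eq; rewrite !coordE; ring.
have s01 : 0 < s <= 1 by rewrite sp.
have BA : B != A by rewrite eq_sym.
have al01' : 0 <= 1 - al <= 1 by lra.
have ze01' : 0 <= 1 - ze <= 1 by lra.
have h1 := segment_ray_end AB hB al01 ze01 s01 xE1 zE1.
have h2 := segment_ray_end BA hA al01' ze01' s01 xE2 zE2.
apply/segmentP; exists (al + (ze - al) / s).
  move: h2; have -> : (1 - ze - (1 - al)) / s = - ((ze - al) / s) by field.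
  by move=> h2; lra.
transitivity (x + s^-1 *: (A + ze *: (B - A) - (A + al *: (B - A)))).
  by rewrite -zE1 -xE1; apply: plane_eq; rewrite !coordE; field.
by rewrite [in LHS]xE1; apply: plane_eq; rewrite !coordE; field.
Unshelve. all: by end_near. Qed.

(** Let [x] be on the curve. If the segment to a nearby [y] meets the curve again, it lies in one
    edge; if not, all of it except [x] lies in the component of [y] in the complement of the
    curve. *)
Lemma region_locally_starshaped : locally_starshaped P.
Proof.
move=> x Px; have [cx|nx] := pselect (curve x); last first.
  near=> y; move=> _ z xyz; apply: (@region_connected (segment x y) x z) => //.
  - exact: connected_segment.
  - by near: y; exact: near_not_curve.
  - exact: segment_l.
near=> y; move=> Py.
have cone : forall i z, segment x y z -> z != x -> segment (v i) (v (ordS i)) z ->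
    segment (v i) (v (ordS i)) x /\ segment (v i) (v (ordS i)) y.
  near: y; apply: filter_forall => i.
  exact: near_segment_cone.
have [[z [xyz zx [i _ iz]]]|h] := pselect (exists z, [/\ segment x y z, z != x & curve z]).
  have [ix iy] := cone i z xyz zx iz.
  apply: subset_trans (@edge_sub_region i) => w.
  move: ix iy => /segmentP[s s01 ->] /segmentP[t t01 ->] /segmentP[l l01 ->].
  apply/segmentP; exists ((1 - l) * s + l * t).
    by move: s01 t01 l01 => /andP[? ?] /andP[? ?] /andP[? ?]; nra.
  by apply: plane_eq; rewrite !coordE; ring.
move=> w xyw; have [->//|wx] := eqVneq w x.
have xyy := segment_r x y.
have yx : y != x.
  apply: contraNneq wx => yx; move: xyw; rewrite yx => /segmentP[t _ ->].
  by rewrite -scalerDl subrK scale1r.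
apply: (@region_connected (segment y w) y w) => //.
- exact: connected_segment.
- move=> z ywz cz; apply: h; exists z; split=> //.
    move: xyw ywz => /segmentP[s s01 ->] /segmentP[l l01 ->].
    apply/segmentP; exists ((1 - l) + l * s).
      by move: s01 l01 => /andP[? ?] /andP[? ?]; nra.
    by apply: plane_eq; rewrite !coordE; ring.
  move: xyw wx ywz => /segmentP[s /andP[s0 s1] ->] wx /segmentP[l /andP[l0 l1] ->].
  have -> : (1 - l) *: y + l *: ((1 - s) *: x + s *: y) = x + (1 - l + l * s) *: (y - x).
    by apply: plane_eq; rewrite !coordE; ring.
  rewrite -subr_eq0 addrC addKr scaler_eq0 subr_eq0 (negbTE yx) orbF.
  have s0' : s != 0.
    by apply: contraNneq wx => ->; rewrite subr0 scale1r scale0r addr0.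
  have sp : 0 < s by rewrite lt_neqAle eq_sym s0'.
  rewrite gt_eqF//; have [->|l1'] := eqVneq l 1; first by lra.
  have : l < 1 by rewrite lt_neqAle l1'.
  have : 0 <= l * s by exact: mulr_ge0.
  lra.
- exact: segment_l.
- exact: segment_r.
Unshelve. all: by end_near. Qed.

Lemma val_iter_ordS (i : 'I_n) k : val (iter k (@ordS n) i) = ((i + k) %% n)%N.
Proof.
elim: k => [|k IH] /=; first by rewrite addn0 modn_small.
by rewrite IH addnS -addn1 modnDml addn1.
Qed.

Lemma region_linked x y : P x -> P y -> linked P x y.
Proof.
pose e1 : plane R := (1, 0).
have e0 : e1 != 0 by rewrite xpair_eqE oner_eq0.
have toc z : P z -> exists2 c, curve c & linked P z c.
  move=> Pz; have [tau [tau0 tauP] tauE] := exit_param closed_region bounded_region Pz e0.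
  exists (z + tau *: e1); last first.
    apply: linked_seg => w /segmentP[l /andP[l0 l1] ->].
    have -> : (1 - l) *: z + l *: (z + tau *: e1) = z + (l * tau) *: e1.
      by apply: plane_eq; rewrite !coordE; ring.
    by apply: tauP; rewrite mulr_ge0//= ler_piMl.
  apply: contrapT => nc.
  have Pc : P (z + tau *: e1) by apply: tauP; rewrite tau0 lexx.
  have : nbhs tau ((fun t : R => z + t *: e1) @^-1` P).
    by apply: (line_cont (p := z) (d := e1)); exact: near_region.
  move=> /nbhs_ballP[e /= ep he].
  have [s hs] := tauE e ep; apply; apply: he; rewrite -ball_normE /=.
  by rewrite ltr_norml; lra.
have tov c i : segment (v i) (v (ordS i)) c -> linked P c (v i).
  move=> h; apply: linked_seg; apply: subset_trans (@edge_sub_region i) => w.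
  move: h => /segmentP[s /andP[s0 s1] ->] /segmentP[l /andP[l0 l1] ->].
  apply/segmentP; exists ((1 - l) * s); first by nra.
  by apply: plane_eq; rewrite !coordE; ring.
have vv i k : linked P (v i) (v (iter k (@ordS n) i)).
  elim: k => [|k IH] /=; first exact: linked_refl.
  by apply: linked_trans IH _; apply: linked_seg; exact: edge_sub_region.
have vall i j : linked P (v i) (v j).
  (* As [i < n], these steps lead from [i] to [j + n], which is [j] modulo [n]. *)
  have -> : j = iter (j + (n - i))%N (@ordS n) i; last exact: vv.
  apply: val_inj; rewrite val_iter_ordS addnCA subnKC; last by case: (i) => m /= /ltnW.
  by rewrite modnDr modn_small.
move=> /toc[c [i _ ic] xc] /toc[c' [j _ jc] yc].
apply: linked_trans xc _; apply: linked_trans (tov _ _ ic) _.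
apply: linked_trans (vall i j) _; apply: linked_sym.
by apply: linked_trans yc _; exact: tov.
Qed.

End PolygonTopology.

(** * Convex vertices *)

Section ConvexVertex.
Context {R : realType} {n : nat} (v : 'I_n -> plane R) (hP : simple_polygon v).
Implicit Types x y z u w d p q a b c : plane R.

Local Notation curve := (polygonal_curve v).
Local Notation P := (polygon_region v).
Local Notation edge i := (segment (v i) (v (ordS i))).

(** The side on which [a] lies depends on the unknown orientation of the polygon; exchanging [z] and
    [z'] reduces one case to the other. A single crossing point serves as both [p] and [q]. *)
Lemma crossing_winding_sym (z z' a b p : plane R) s (U U' : set (plane R)) (mu : R) :
  let d := z - z' in
  last a s = b -> crossp d (a - z) * crossp d (b - z) < 0 ->
  0 < mu < 1 -> p = z' + mu *: d ->
  chain (~` segment z' z) a s ->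
  connected U -> ~ bounded_set U -> U z -> chain (~` U) a (s ++ [:: p; p; a]) ->
  connected U' -> ~ bounded_set U' -> U' z' -> chain (~` U') a (s ++ [:: p; p; a]) ->
  False.
Proof.
move=> d lb ab mu01 pE chs cU bU Uz chU cU' bU' Uz' chU'.
have [ad|ad|ad] := ltgtP 0 (crossp d (a - z)).
- have bd : crossp d (b - z) < 0 by move: ab; rewrite pmulr_rlt0.
  exact: (crossing_winding lb ad bd mu01 pE mu01 pE chs cU bU Uz chU cU' bU' Uz' chU').
- have bd : 0 < crossp d (b - z) by move: ab; rewrite nmulr_rlt0.
  have mu01' : 0 < 1 - mu < 1 by lra.
  have pE' : p = z + (1 - mu) *: (z' - z).
    by rewrite pE /d; apply: plane_eq; rewrite !coordE; ring.
  have sw c : crossp (z' - z) (c - z') = - crossp d (c - z).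
    by rewrite /d /crossp !coordE; ring.
  rewrite segmentC in chs.
  apply: (crossing_winding lb _ _ mu01' pE' mu01' pE' chs cU' bU' Uz' chU' cU bU Uz chU);
    by rewrite sw ?oppr_gt0 ?oppr_lt0.
- by move: ab; rewrite -ad mul0r ltxx.
Qed.

(** Positivity in the lexicographic order: height over the direction [d], then position along [d].
    The tie-break excludes minima in the middle of an edge parallel to [d]. *)
Definition lexpos d w := 0 < crossp d w \/ crossp d w = 0 /\ 0 < dotp d w.

Lemma lexposZ d (k : R) w : 0 < k -> lexpos d w -> lexpos d (k *: w).
Proof.
have e1 : crossp d (k *: w) = k * crossp d w by rewrite /crossp !coordE; ring.
have e2 : dotp d (k *: w) = k * dotp d w by rewrite /dotp !coordE; ring.
move=> k0; rewrite /lexpos e1 e2 => -[h|[h1 h2]]; first by left; rewrite mulr_gt0.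
by right; rewrite h1 mulr0 mulr_gt0.
Qed.

Lemma lexpos_total d w : d != 0 -> w != 0 -> lexpos d w \/ lexpos d (- w).
Proof.
move=> d0 w0.
have e1 : crossp d (- w) = - crossp d w by rewrite /crossp !coordE; ring.
have e2 : dotp d (- w) = - dotp d w by rewrite /dotp !coordE; ring.
rewrite /lexpos e1 e2 !oppr_gt0.
have [h|h|h] := ltgtP 0 (crossp d w); [by left; left|by right; left|].
have [h'|h'|h'] := ltgtP 0 (dotp d w); [by left; right|by right; right; rewrite -h oppr0|].
have := lagrange_id d w; rewrite -h -h' expr0n addr0 => /esym/eqP.
by rewrite mulf_eq0 !dotp_eq0 (negbTE d0) (negbTE w0).
Qed.

Lemma lexpos_irr d w : lexpos d w -> lexpos d (- w) -> False.
Proof.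
have e1 : crossp d (- w) = - crossp d w by rewrite /crossp !coordE; ring.
have e2 : dotp d (- w) = - dotp d w by rewrite /dotp !coordE; ring.
rewrite /lexpos e1 e2 => -[h|[h h1]] [h'|[h' h1']]; lra.
Qed.

Lemma parallelE x y : crossp x y = 0 -> dotp x x *: y = dotp x y *: x.
Proof.
move=> xy; apply: plane_eq; rewrite !coordE.
  transitivity (dotp x y * x.1 - x.2 * crossp x y); last by rewrite xy mulr0 subr0.
  by rewrite /dotp /crossp; ring.
transitivity (dotp x y * x.2 + x.1 * crossp x y); last by rewrite xy mulr0 addr0.
by rewrite /dotp /crossp; ring.
Qed.

Let v_edge0 i : edge_point v i 0 = v i.
Proof. by rewrite /edge_point subr0 scale1r scale0r addr0. Qed.

Let v_edge1 i : edge_point v i 1 = v (ordS i).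
Proof. by rewrite /edge_point subrr scale1r scale0r add0r. Qed.

Lemma ordS_neq (i : 'I_n) : ordS i != i.
Proof.
have [n3 _ _] := hP; apply/eqP => /(congr1 val) /= e.
have := ltn_ord i; rewrite leq_eqVlt => /orP[/eqP h|h].
  by move: e; rewrite h modnn => e; move: h n3; rewrite -e => <-.
by move: e; rewrite modn_small// => /esym /n_Sn.
Qed.

Lemma vertex_inj i j : v i = v j -> i = j.
Proof.
have [_ simp _] := hP => e; have := simp i j 0 0; rewrite lexx ltr01 !v_edge0.
by case.
Qed.

Lemma vertex_on_edge i j : edge i (v j) -> i = j \/ ordS i = j.
Proof.
have [_ simp _] := hP => /segmentP[t /andP[t0]]; rewrite le_eqVlt => /orP[/eqP ->|t1] e.
  by right; apply: vertex_inj; rewrite -v_edge1; exact: esym e.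
have e' : edge_point v i t = edge_point v j 0 by rewrite v_edge0.
by left; have [] := simp i j t 0 _ _ e'; rewrite ?t0 ?lexx ?ltr01.
Qed.

Lemma wedge_convex j : wedge_inside v j -> convex_vertex v j.
Proof.
move=> wj; have [_ _ /(_ j) nj] := hP.
rewrite /convex_vertex lt_neqAle nj /internal_angle.
case: asboolP => // _; rewrite /angle; set x := v _ - v j; set y := v _ - v j.
apply: acos_lepi; rewrite -ler_norml.
(* A zero denominator makes the quotient 0, which is still in the domain of [acos]. *)
have [->|N0] := eqVneq (enorm x * enorm y) 0; first by rewrite invr0 mulr0 normr0 ler01.
have Np : 0 < enorm x * enorm y by rewrite lt_neqAle eq_sym N0 mulr_ge0// enorm_ge0.
by rewrite normrM normfV (ger0_norm (ltW Np)) ler_pdivrMr// mul1r dotp_le.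
Qed.

Lemma chain_traject A j m : (forall i, i \in traject (@ordS n) j m -> edge i `<=` A) ->
  chain A (v j) (map v (traject (@ordS n) (ordS j) m)).
Proof.
elim: m j => [|m IH] j //= h; split; first by apply: h; rewrite mem_head.
by apply: IH => i im; apply: h; rewrite in_cons im orbT.
Qed.

(** [n.-1] steps from [j] run through every edge but the one that ends at [v j]. *)
Lemma traject_neq_pred (i j : 'I_n) : i \in traject (@ordS n) j n.-1 -> i != ord_pred j.
Proof.
move=> /trajectP[k kn ->]; apply/eqP => /(congr1 val); rewrite val_iter_ordS /=.
have n0 : (0 < n)%N by apply: leq_trans (ltn_ord j).
have -> : (j + n).-1 = (j + n.-1)%N by move: n0; clear; lia.
move=> /eqP; rewrite eqn_modDl !modn_small ?prednK// => [/eqP e|].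
  by rewrite e ltnn in kn.
by apply: leq_trans kn _; exact: leq_pred.
Qed.

(* If the sector between the two edges at [v j] contained a point [z] outside the
   region, then a segment from [z] across one of the edges would lead to another
   point [z'] outside the region and meet the boundary curve only once. *)
Lemma near_lexmin d u : d != 0 -> P u ->
  (\forall y \near u, P y -> ~ lexpos d (u - y)) ->
  exists j, u = v j /\ convex_vertex v j.
Proof.
move=> d0 Pu umin.
have [n3 simp _] := hP.
(* Of two opposite directions one descends lexicographically, so [u] is not an inner point of a
   segment contained in [P]. *)
have escape w : w != 0 -> (\forall t \near (0 : R), P (u + t *: w)) -> False.
  move=> w0 Pw.
  have : \forall t \near (0 : R), P (u + t *: w) /\
      (P (u + t *: w) -> ~ lexpos d (u - (u + t *: w))).
    apply: filterS2 Pw _; last first.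
      apply: (line_cont (p := u) (d := w) (x := 0)); rewrite scale0r addr0; exact: umin.
    by move=> t.
  move=> /nbhs_ballP[e /= e0 he].
  have half t : `|t| < e -> ~ lexpos d (- (t *: w)).
    move=> te; have [|Pt] := he t; first by rewrite -ball_normE /= sub0r normrN.
    by rewrite opprD addrA subrr sub0r; apply.
  have e2 : `|e / 2| < e by rewrite ger0_norm; lra.
  have [h|h] := lexpos_total d0 w0.
    apply: (half (- (e / 2))); first by rewrite normrN.
    by rewrite scaleNr opprK; apply: (lexposZ _ h); lra.
  by apply: (half _ e2); rewrite -scalerN; apply: (lexposZ _ h); lra.
have cu : curve u.
  apply: contrapT => nc; apply: (escape d) => //.
  apply: (line_cont (p := u) (d := d) (x := 0)); rewrite scale0r addr0.
  exact: near_region.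
have [j uj] : exists j, u = v j.
  have [i _ /segmentP[t /andP[t0 t1] ut]] := cu.
  have [tt|t0'] := eqVneq t 0; first by exists i; rewrite ut tt; exact: v_edge0.
  have [tt|t1'] := eqVneq t 1; first by exists (ordS i); rewrite ut tt; exact: v_edge1.
  exfalso; apply: (escape (v (ordS i) - v i)).
    by rewrite subr_eq0; apply: contra_neq (ordS_neq i) => /vertex_inj.
  have tp : 0 < t by rewrite lt_neqAle eq_sym t0'.
  have tl : t < 1 by rewrite lt_neqAle t1'.
  near=> s; apply: (@edge_sub_region _ _ v i); apply/segmentP; exists (t + s).
    have : `|s| < t by near: s; exact: (@nbhs0_lt R R^o).
    have : `|s| < 1 - t by near: s; apply: (@nbhs0_lt R R^o); rewrite subr_gt0.
    rewrite !ltr_norml; lra.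
  by rewrite ut; apply: plane_eq; rewrite !coordE; ring.
exists j; split=> //; apply: wedge_convex; subst u.
set pj := ord_pred j.
have Spj : ordS pj = j by exact: ord_predK.
have pjj : pj != j by apply: contra_neq (ordS_neq pj) => e; rewrite Spj e.
have [A AE] : exists A, A = v pj - v j by exists (v pj - v j).
have [B BE] : exists B, B = v (ordS j) - v j by exists (v (ordS j) - v j).
have vpj : v pj = v j + A by rewrite AE addrC subrK.
have vSj : v (ordS j) = v j + B by rewrite BE addrC subrK.
have A0 : A != 0 by rewrite AE subr_eq0; apply: contra_neq pjj => /vertex_inj.
have B0 : B != 0 by rewrite BE subr_eq0; apply: contra_neq (ordS_neq j) => /vertex_inj.
have eA s : 0 <= s <= 1 -> edge pj (v j + s *: A).
  move=> s01; rewrite segmentC Spj vpj; apply/segmentP; exists s => //.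
  by apply: plane_eq; rewrite !coordE; ring.
have eB s : 0 <= s <= 1 -> edge j (v j + s *: B).
  move=> s01; rewrite vSj; apply/segmentP; exists s => //.
  by apply: plane_eq; rewrite !coordE; ring.
have PA s : 0 <= s <= 1 -> P (v j + s *: A) by move=> /eA/edge_sub_region.
have PB s : 0 <= s <= 1 -> P (v j + s *: B) by move=> /eB/edge_sub_region.
have away : \forall y \near v j, forall i, i != j -> i != pj -> ~ edge i y.
  apply: (@filter_forall _ _ (fun i y => i != j -> i != pj -> ~ edge i y) (nbhs (v j)) _) => i.
  have [->|ij] := eqVneq i j; first by near=> y.
  have [->|ipj] := eqVneq i pj; first by near=> y.
  have : nbhs (v j) (~` edge i).
    apply: open_nbhs_nbhs; split; first exact/closed_openC/closed_segment.
    move=> /vertex_on_edge[e|e]; first by rewrite e eqxx in ij.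
    by move: ipj; rewrite /pj -e ordSK eqxx.
  by apply: filterS => y.
have good : \forall y \near v j, (P y -> ~ lexpos d (v j - y)) /\
    forall i, i != j -> i != pj -> ~ edge i y.
  by apply: filterS2 umin away => y.
move: good => /nbhs_ballP[e /= e0 good].
pose N := `|A| + `|B|.
have N0 : 0 < N by rewrite addr_gt0// normr_gt0.
(* [e / (2 * N)] keeps the small parallelogram in the ball of radius [e]; [1 / 2] keeps its sides
   well inside the two edges. *)
pose r := Num.min (1 / 2) (e / (2 * N)).
have r0 : 0 < r by rewrite lt_min !divr_gt0// mulr_gt0.
have r1 : r <= 1 / 2 by rewrite ge_min lexx.
have goodr s t : `|s| <= r -> `|t| <= r -> let y := v j + s *: A + t *: B in
    (P y -> ~ lexpos d (v j - y)) /\ forall i, i != j -> i != pj -> ~ edge i y.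
  move=> sr tr y; apply: good; rewrite -ball_normE /=.
  have -> : v j - y = - (s *: A + t *: B) by rewrite /y -addrA opprD addrA subrr sub0r.
  rewrite normrN; apply: le_lt_trans (ler_normD _ _) _; rewrite !normrZ.
  apply: (@le_lt_trans _ _ (r * N)).
    by rewrite /N mulrDr; apply: lerD; apply: ler_wpM2r.
  have : r * N <= e / 2.
    by rewrite -ler_pdivlMr// -mulrA -invfM ge_min lexx orbT.
  move: e0; lra.
have rr s : 0 <= s <= r -> `|s| <= r by move=> /andP[h1 h2]; rewrite ger0_norm.
have r00 : `|0 : R| <= r by rewrite normr0 ltW.
have posA : lexpos d A.
  have [//|h] := lexpos_total d0 A0; exfalso.
  have [] := goodr r 0 (rr _ _) r00; first by rewrite lexx ltW.
  rewrite scale0r addr0 => + _; apply; first by apply: PA; lra.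
  by rewrite opprD addrA subrr sub0r -scalerN; apply: lexposZ.
have posB : lexpos d B.
  have [//|h] := lexpos_total d0 B0; exfalso.
  have [] := goodr 0 r r00 (rr _ _); first by rewrite lexx ltW.
  rewrite scale0r addr0 => + _; apply; first by apply: PB; lra.
  by rewrite opprD addrA subrr sub0r -scalerN; apply: lexposZ.
(* If parallel, the edges point the same way, since both are lexicographically positive; the radius
   [(1 + la)^-1] keeps [s + t * la] at most 1. *)
have [AB|AB] := eqVneq (crossp A B) 0.
  pose la := dotp A B / dotp A A.
  have AA : 0 < dotp A A by rewrite lt_neqAle dotp_ge0 eq_sym dotp_eq0 A0.
  have BA : B = la *: A.
    have AAn : dotp A A != 0 by rewrite gt_eqF.
    by apply: (scalerI AAn); rewrite parallelE// scalerA /la mulrC divfK.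
  have la0 : 0 < la.
    have [//|h|h] := ltgtP 0 la; last by rewrite BA -h scale0r eqxx in B0.
    exfalso; apply: (lexpos_irr posB); rewrite BA -scaleNr; apply: lexposZ => //.
    by rewrite oppr_gt0.
  exists (1 + la)^-1; first by rewrite invr_gt0 addr_gt0.
  move=> s t /andP[s0 sl] /andP[t0 tl]; rewrite -AE -BE BA scalerA -addrA -scalerDl.
  have h1 : 0 <= t * la by rewrite mulr_ge0// ltW.
  have h2 : t * la <= (1 + la)^-1 * la by rewrite ler_wpM2r// ltW.
  have h3 : (1 + la)^-1 * (1 + la) = 1 by rewrite mulVf// gt_eqF// addr_gt0.
  by apply: PA; lra.
exists r; first exact: r0.
move=> s t /andP[s0 sr] /andP[t0 tr]; rewrite -AE -BE.
apply: contrapT => nPz.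
have [st0|sn] := eqVneq s 0.
  by apply: nPz; rewrite st0 scale0r addr0; apply: PB; lra.
have [tt0|tn] := eqVneq t 0.
  by apply: nPz; rewrite tt0 scale0r addr0; apply: PA; lra.
have sp : 0 < s by rewrite lt_neqAle eq_sym sn.
have tp : 0 < t by rewrite lt_neqAle eq_sym tn.
move: nPz; move zE : (v j + s *: A + t *: B) => z nPz.
(* [z'] mirrors [z] across the line of [A] in the direction [B]. Its shift [z''] along [A] lies on
   the line of [B], lexicographically below [v j] and hence outside [P]; as the curve does not meet
   the segment between them, [z'] is outside too. *)
move z'E : (v j + s *: A + (- t) *: B) => z'.
move z''E : (v j + 0 *: A + (- t) *: B) => z''.
have indep s1 t1 s2 t2 : v j + s1 *: A + t1 *: B = v j + s2 *: A + t2 *: B -> s1 = s2 /\ t1 = t2.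
  move=> h0; have h : (s1 - s2) *: A + (t1 - t2) *: B = 0.
    transitivity (v j + s1 *: A + t1 *: B - (v j + s2 *: A + t2 *: B)); last by rewrite h0 subrr.
    by apply: plane_eq; rewrite !coordE; ring.
  have h1 : (s1 - s2) * crossp A B = 0.
    transitivity (crossp ((s1 - s2) *: A + (t1 - t2) *: B) B).
      by rewrite /crossp !coordE; ring.
    by rewrite h /crossp /= !mul0r subrr.
  have h2 : (t1 - t2) * crossp A B = 0.
    transitivity (crossp A ((s1 - s2) *: A + (t1 - t2) *: B)).
      by rewrite /crossp !coordE; ring.
    by rewrite h /crossp /= !mulr0 subrr.
  by move: h1 h2 => /eqP + /eqP; rewrite !mulf_eq0 (negbTE AB) !orbF !subr_eq0 => /eqP -> /eqP ->.
have edgeA y : edge pj y -> exists2 k, 0 <= k <= 1 & y = v j + k *: A + 0 *: B.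
  rewrite segmentC Spj vpj => /segmentP[k k01 ->]; exists k => //.
  by apply: plane_eq; rewrite !coordE; ring.
have edgeB y : edge j y -> exists2 k, 0 <= k <= 1 & y = v j + 0 *: A + k *: B.
  rewrite vSj => /segmentP[k k01 ->]; exists k => //.
  by apply: plane_eq; rewrite !coordE; ring.
have nbelow s' : 0 <= s' <= s -> ~ curve (v j + s' *: A + (- t) *: B).
  move=> /andP[s'0 s's] [i _].
  have [->|ij] := eqVneq i j; first by move=> /edgeB[k k01 /indep[]]; lra.
  have [->|ipj] := eqVneq i pj; first by move=> /edgeA[k k01 /indep[]]; lra.
  have [] := goodr s' (- t) (rr _ _) _; [lra|by rewrite normrN rr// t0|].
  by move=> _ /(_ i ij ipj).
have nz'' : ~ P z''.
  move=> Pz''; have [] := goodr 0 (- t) r00 _; first by rewrite normrN rr// t0.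
  rewrite z''E => /(_ Pz'') + _; apply; rewrite -z''E.
  by rewrite scale0r addr0 scaleNr opprB addrCA subrr addr0; exact: lexposZ.
have nz' : ~ P z'.
  move=> Pz'; apply: nz''; apply: (@region_connected _ _ v (segment z' z'') z' z'') => //.
  - exact: connected_segment.
  - move=> y /segmentP[l /andP[l0 l1] ->].
    have -> : (1 - l) *: z' + l *: z'' = v j + ((1 - l) * s) *: A + (- t) *: B.
      by rewrite -z'E -z''E; apply: plane_eq; rewrite !coordE; ring.
    by apply: nbelow; rewrite mulr_ge0 ?ler_piMl//; clear -hP l0 l1; lra.
  - exact: segment_l.
  - exact: segment_r.
have [U [cU bU Uz UP]] := filled_region nPz.
have [U' [cU' bU' Uz' UP']] := filled_region nz'.
pose sq := map v (traject (@ordS n) (ordS j) n.-1).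
have lsq : last (v j) sq = v pj.
  rewrite /sq last_map last_traject; congr v.
  apply: val_inj; rewrite val_iter_ordS /=; congr (_ %% _)%N.
  by move: n3; clear; lia.
have npj i : i \in traject (@ordS n) j n.-1 -> i != pj by exact: traject_neq_pred.
(* [m] is the midpoint of [z'] and [z], where the segment between them crosses the edge into [v j];
   the ends of this edge lie on opposite sides. *)
move mE : (v j + s *: A) => m.
have dE : z - z' = (2 * t) *: B by rewrite -zE -z'E; apply: plane_eq; rewrite !coordE; ring.
have loopP : chain P (v j) (sq ++ [:: m; m; v j]).
  apply/chain_cat; split; first by apply: chain_traject => i _; exact: edge_sub_region.
  have jm k1 k2 : 0 <= k1 <= 1 -> 0 <= k2 <= 1 -> segment (v j + k1 *: A) (v j + k2 *: A) `<=` P.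
    move=> /andP[k10 k11] /andP[k20 k21] y /segmentP[l /andP[l0 l1] ->].
    have -> : (1 - l) *: (v j + k1 *: A) + l *: (v j + k2 *: A) =
        v j + ((1 - l) * k1 + l * k2) *: A.
      by apply: plane_eq; rewrite !coordE; ring.
    by apply: PA; clear -hP k10 k11 k20 k21 l0 l1; nra.
  rewrite lsq /=; have -> : v pj = v j + 1 *: A by rewrite scale1r vpj.
  rewrite -mE; split; first by apply: jm; clear -hP s0 sr r1; lra.
  split; first by apply: jm; clear -hP s0 sr r1; lra.
  have e00 : v j = v j + 0 *: A by rewrite scale0r addr0.
  by split=> //; rewrite {2}e00; apply: jm; clear -hP s0 sr r1; lra.
apply: (@crossing_winding_sym z z' (v j) (v pj) m sq U U' (1 / 2)) => //.
- rewrite dE.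
  have -> : crossp ((2 * t) *: B) (v j - z) = 2 * t * s * crossp A B.
    by rewrite -zE /crossp !coordE; ring.
  have -> : crossp ((2 * t) *: B) (v pj - z) = - (2 * t * (1 - s) * crossp A B).
    by rewrite -zE vpj /crossp !coordE; ring.
  have : 0 < crossp A B ^+ 2 by rewrite lt_neqAle eq_sym sqrf_eq0 AB sqr_ge0.
  have : 0 < 4 * t ^+ 2 * s * (1 - s).
    by rewrite !mulr_gt0 ?exprn_gt0//; lra.
  move=> h1 h2; have := mulr_gt0 h1 h2; rewrite mulrN oppr_lt0.
  by congr (0 < _); ring.
- lra.
- by rewrite dE -mE -z'E; apply: plane_eq; rewrite !coordE; field.
- apply: chain_traject => i /npj ipj y iy /segmentP[l /andP[l0 l1] yE].
  have {}yE : y = v j + s *: A + ((2 * l - 1) * t) *: B.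
    by rewrite yE -zE -z'E; apply: plane_eq; rewrite !coordE; ring.
  have [ij|ij] := eqVneq i j.
    by move: iy; rewrite ij yE => /edgeB[k k01 /indep[]]; lra.
  have [] := goodr s ((2 * l - 1) * t) (rr _ _) _; [lra| |].
    rewrite normrM (ger0_norm t0).
    have : `|2 * l - 1| <= 1 by rewrite ler_norml; lra.
    by move=> h; apply: le_trans tr; rewrite ler_piMl.
  by move=> _ /(_ i ij ipj); rewrite -yE.
- by apply: sub_chain loopP => x Px /UP.
- by apply: sub_chain loopP => x Px /UP'.
Unshelve. all: by end_near. Qed.

End ConvexVertex.

(** * Visibility along lines, and closedness of visibility *)

Section Visibility.
Context {R : realType}.
Implicit Types x y z u w d p q a b c : plane R.
Implicit Types P : set (plane R).

Lemma line_segment p d (r s t : R) : r <= s <= t \/ t <= s <= r ->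
  segment (p + r *: d) (p + t *: d) (p + s *: d).
Proof.
move=> rst; apply/segmentP; have [rt|rt] := eqVneq r t.
  exists 0; first by rewrite lexx ler01.
  have -> : s = r by case: rst; rewrite rt => h; apply/eqP; rewrite eq_le andbC.
  by rewrite subr0 scale1r scale0r addr0.
exists ((s - r) / (t - r)); last first.
  apply: plane_eq; rewrite !coordE; field; by rewrite subr_eq0 eq_sym.
case: rst => [|] rst.
  have h : 0 < t - r by rewrite subr_gt0 lt_neqAle rt; lra.
  by rewrite divr_ge0 ?ler_pdivrMr ?mul1r//; lra.
have h : 0 < r - t by rewrite subr_gt0 lt_neqAle eq_sym rt; lra.
have -> : (s - r) / (t - r) = (r - s) / (r - t) by rewrite -[r - s]opprB -[r - t]opprB invrN mulrNN.
by rewrite divr_ge0 ?ler_pdivrMr ?mul1r//; lra.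
Qed.

Lemma collinear_sees P p d (r t : R) : sees P p (p + r *: d) ->
  sees P (p + r *: d) (p + t *: d) -> sees P p (p + t *: d).
Proof.
move=> h1 h2 x /segmentP[l /andP[l0 l1] ->].
have -> : (1 - l) *: p + l *: (p + t *: d) = p + (l * t) *: d.
  by apply: plane_eq; rewrite !coordE; ring.
have first_part : 0 <= l * t <= r \/ r <= l * t <= 0 -> P (p + (l * t) *: d).
  move=> h; apply: h1; rewrite -{1}[p]addr0 -(scale0r d).
  exact: line_segment.
have last_part : r <= l * t <= t \/ t <= l * t <= r -> P (p + (l * t) *: d).
  by move=> h; apply: h2; exact: line_segment.
have [t0|t0] := leP 0 t.
  have lt0 : 0 <= l * t by rewrite mulr_ge0.
  have lt1 : l * t <= t by rewrite ler_piMl.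
  have [h|h] := leP (l * t) r; first by apply: first_part; left; lra.
  by apply: last_part; left; lra.
have lt0 : l * t <= 0 by rewrite mulr_ge0_le0// ltW.
have lt1 : t <= l * t by rewrite ler_niMl// ltW.
have [h|h] := leP r (l * t); first by apply: first_part; right; lra.
by apply: last_part; right; lra.
Qed.

Lemma crossp_line p d x : d != 0 -> crossp d (x - p) = 0 -> exists t : R, x = p + t *: d.
Proof.
move=> d0 h; exists (dotp d (x - p) / dotp d d).
have dd : dotp d d != 0 by rewrite dotp_eq0.
have e : x - p = (dotp d (x - p) / dotp d d) *: d.
  by apply: (scalerI dd); rewrite parallelE// scalerA mulrC divfK.
by rewrite -e addrC subrK.
Qed.

Lemma line_crossp p d (t : R) : crossp d (p + t *: d - p) = 0.
Proof. by rewrite addrC addKr /crossp !coordE; ring. Qed.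

Lemma chordP P p d x : d != 0 -> chord P p d x <-> crossp d (x - p) = 0 /\ sees P p x.
Proof.
move=> d0; split=> [[[t ->] h]|[/crossp_line h1 h2]].
  by split=> //; exact: line_crossp.
by split=> //; exact: h1.
Qed.

Lemma sees_closed P : closed P ->
  closed [set xy : plane R * plane R | sees P xy.1 xy.2].
Proof.
move=> cP.
have -> : [set xy : plane R * plane R | sees P xy.1 xy.2] =
    \bigcap_(t in [set t : R | 0 <= t <= 1])
      ((fun xy : plane R * plane R => (1 - t) *: xy.1 + t *: xy.2) @^-1` P).
  apply/seteqP; split=> xy /= h.
    by move=> t t01; apply: h; apply/segmentP; exists t.
  by move=> z /segmentP[t t01 ->]; exact: h.
apply: closed_bigI => t _; apply: preimage_closed => // xy _.
apply: (@continuousD _ _ _ (fun xy : plane R * plane R => (1 - t) *: xy.1)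
  (fun xy : plane R * plane R => t *: xy.2)).
  by apply: (@continuousZl_tmp _ _ _ (fun xy : plane R * plane R => xy.1)); exact: cvg_fst.
by apply: (@continuousZl_tmp _ _ _ (fun xy : plane R * plane R => xy.2)); exact: cvg_snd.
Qed.

Lemma sees_l_closed P p : closed P -> closed [set x | sees P p x].
Proof.
move=> cP.
have -> : [set x | sees P p x] =
    \bigcap_(t in [set t : R | 0 <= t <= 1]) ((fun x => (1 - t) *: p + t *: x) @^-1` P).
  apply/seteqP; split=> x /= h.
    by move=> t t01; apply: h; apply/segmentP; exists t.
  by move=> z /segmentP[t t01 ->]; exact: h.
apply: closed_bigI => t _; apply: preimage_closed => // x _.
by apply: cvgD; [exact: cvg_cst|apply: cvgZl_tmp; exact: cvg_id].
Qed.

Lemma crossp_continuous d p : continuous (fun x : plane R => crossp d (x - p)).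
Proof.
move=> x; apply: (crossp_cont (f := fun=> d) (g := fun x => x - p)); first exact: cvg_cst.
by apply: continuousB; [exact: cvg_id|exact: cvg_cst].
Qed.

Lemma closed_chord P p d : closed P -> d != 0 -> closed (chord P p d).
Proof.
move=> cP d0.
have -> : chord P p d = (fun x => crossp d (x - p)) @^-1` [set t | t = 0] `&` [set x | sees P p x].
  by apply/seteqP; split=> x /(chordP _ _ _ d0).
apply: closedI; last exact: sees_l_closed.
by apply: preimage_closed => [x _|]; [exact: crossp_continuous|exact: closed_eq].
Qed.

Lemma chord_refl P p d : P p -> chord P p d p.
Proof.
move=> Pp; split; first by exists 0; rewrite scale0r addr0.
by move=> x /segmentP[t _ ->]; rewrite -scalerDl subrK scale1r.
Qed.

End Visibility.

(** * A convex vertex behind every chord *)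

Section BelowChord.
Context {R : realType} {n : nat} (v : 'I_n -> plane R) (hP : simple_polygon v).
Implicit Types x y z u w d p q a b c : plane R.

Local Notation P := (polygon_region v).

(* Take the lexicographically lowest point among those not linked to the upper
   side of the chord. *)
Lemma convex_vertex_below p d : P p -> d != 0 ->
  exists j, [/\ convex_vertex v j,
    forall x, sees P (v j) x -> crossp d (v j) <= crossp d x &
    chord P p d (v j) \/
    forall a c, 0 < crossp d (a - p) -> chord P p d c -> sees P c a ->
      ~ linked (P `\` chord P p d) (v j) a].
Proof.
move=> Pp d0.
have cP := @closed_region _ _ v.
have cC : closed (chord P p d) by exact: closed_chord.
have lsP := @region_locally_starshaped _ _ v.
have lsD := locally_starshapedD lsP cC.
(* [Up] is open relative to [P], so its complement [S] is compact, and two successive minimisations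
   reach the lexicographic minimum of [S]. *)
pose Up := [set x | (P `\` chord P p d) x /\ exists a c,
  [/\ 0 < crossp d (a - p), chord P p d c, sees P c a & linked (P `\` chord P p d) x a]].
have Up_near x : Up x -> \forall y \near x, P y -> Up y.
  move=> [Dx [a [c [ha hc hca xa]]]]; near=> y; move=> Py.
  have Cy : ~ chord P p d y.
    near: y; apply: open_nbhs_nbhs; split; first exact: closed_openC.
    by case: Dx.
  have Dy : (P `\` chord P p d) y by [].
  split=> //; exists a, c; split=> //; apply: linked_trans xa.
  apply: linked_sym; move: Dy; near: y; apply: near_linked => //.
  exact: linked_refl.
pose S := P `\` Up.
have cS : compact S.
  apply: (@subclosed_compact _ _ P); [|exact: compact_region|exact: subDsetl].
  move=> x cSx.
  have Px : P x by rewrite (closure_id P).1//; apply: closureS cSx; exact: subDsetl.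
  split=> // /Up_near h; have [y [[Py nUy] hy]] := cSx _ h.
  exact/nUy/hy.
have Sp : S p by split=> // -[[_ +] _]; apply; exact: chord_refl.
have cross_cont w : continuous (fun x : plane R => crossp w x).
  by move=> x; apply: (crossp_cont (f := fun=> w) (g := id)); [exact: cvg_cst|exact: cvg_id].
have dot_cont w : continuous (fun x : plane R => dotp w x).
  by move=> x; apply: (dotp_cont (f := fun=> w) (g := id)); [exact: cvg_cst|exact: cvg_id].
have [u1 /set_mem Su1 u1min] := 
  @compact_EVT_min _ _ (crossp d) S (ex_intro _ p Sp) cS (continuous_subspaceT (cross_cont d)).
pose S1 := S `&` (crossp d @^-1` [set t | t = crossp d u1]).
have cS1 : compact S1.
  apply: compact_closedI => //; apply: preimage_closed; last exact: closed_eq.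
  by move=> x _; exact: cross_cont.
have S1u1 : S1 u1 by split.
have [u /set_mem [Su ueq] umin] := 
  @compact_EVT_min _ _ (dotp d) S1 (ex_intro _ u1 S1u1) cS1 (continuous_subspaceT (dot_cont d)).
have ulow y : S y -> ~ lexpos d (u - y).
  move=> Sy.
  have e1 : crossp d (u - y) = crossp d u - crossp d y by rewrite /crossp !coordE; ring.
  have e2 : dotp d (u - y) = dotp d u - dotp d y by rewrite /dotp !coordE; ring.
  have h1 := u1min y (mem_set Sy); rewrite /= in ueq.
  move=> [|[]]; rewrite e1 ?e2; first by rewrite ueq; lra.
  move=> h h2; have : S1 y by split=> //=; lra.
  by move=> /mem_set/umin; lra.
have [Pu nUu] := Su.
(* Minimality has to be extended from [S] to nearby points of [Up]. If [u] is off the chord, there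
   are none. If [u] is on it, such a point is not below [u] because the chord separates, and not
   level with [u] because it would lie on the chord. *)
have ulocal : \forall y \near u, P y -> ~ lexpos d (u - y).
  have [Cu|Cu] := pselect (chord P p d u); last first.
    near=> y; move=> Py; apply: ulow; split=> // Uy; apply: nUu; split=> //.
    have [Dy [a [c [ha hc hca ya]]]] := Uy; exists a, c; split=> //.
    apply: linked_trans ya; move: Dy; near: y; apply: near_linked => //.
    exact: linked_refl.
  near=> y; move=> Py.
  have uy : sees P u y by move: Py; near: y; exact: lsP.
  have [Uy|] := pselect (Up y); last by move=> nU; apply: ulow.
  have [cu seeu] := (chordP _ _ _ d0).1 Cu.
  have [[_ nCy] [a [c [ha hc hca ya]]]] := Uy.
  have e1 : crossp d (u - y) = crossp d (u - p) - crossp d (y - p) by rewrite /crossp !coordE; ring.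
  move=> [|[]]; rewrite e1 cu.
    move=> h; apply: (chord_separates cP (@bounded_region _ _ v) (@filled_region _ _ v) Pp d0
      hc ha hca Cu _ uy (linked_sym ya)).
    lra.
  move=> h _; apply: nCy; apply/chordP => //.
  have hy : crossp d (y - p) = 0 by lra.
  split=> //.
  have [t1 uE] := crossp_line d0 cu; have [t2 yE] := crossp_line d0 hy.
  by rewrite yE; apply: (@collinear_sees _ _ _ _ t1); rewrite -uE// -yE.
have [j [uj cj]] := near_lexmin hP d0 Pu ulocal.
exists j; rewrite -uj; split=> //.
  move=> x ux; rewrite leNgt; apply/negP => xu.
  have : \forall y \near u, P y -> crossp d u <= crossp d y.
    apply: filterS ulocal => y h /h; rewrite /lexpos leNgt => h'; apply/negP => h2; apply: h'; left.
    have -> : crossp d (u - y) = crossp d u - crossp d y by rewrite /crossp !coordE; ring.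
    by rewrite subr_gt0.
  have h0 : u = u + 0 *: (x - u) by rewrite scale0r addr0.
  rewrite {1}h0 => /(line_cont (p := u) (d := x - u)) /nbhs_ballP[e /= e0 he].
  pose t := Num.min (e / 2) 1.
  have t0 : 0 < t by rewrite lt_min ltr01 andbT; lra.
  have t1 : t <= 1 by rewrite ge_min lexx orbT.
  have te : t <= e / 2 by rewrite ge_min lexx.
  have := he t; rewrite -ball_normE /= sub0r normrN gtr0_norm//.
  move=> /(_ _ _)/wrap[]; first by lra.
    apply: ux; apply/segmentP; exists t; first by rewrite t1 ltW.
    by apply: plane_eq; rewrite !coordE; ring.
  have -> : crossp d (u + t *: (x - u)) = crossp d u - t * (crossp d u - crossp d x).
    by rewrite /crossp !coordE; ring.
  have : 0 < t * (crossp d u - crossp d x) by rewrite mulr_gt0// subr_gt0.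
  lra.
have [Cu|Cu] := pselect (chord P p d u); [by left|right=> a c ha hc hca ua].
by apply: nUu; split=> //; exists a, c.
Unshelve. all: by end_near. Qed.

End BelowChord.

(** * Routes see every point *)

Section CompactConnected.
Context {R : realType}.
Implicit Types x y z u w d p q a b c : plane R.

Lemma linked_connected (A : set (plane R)) x y : A x -> linked A x y ->
  exists X, [/\ connected X, X `<=` A, X x & X y].
Proof.
move=> Ax [s + <-]; elim: s x Ax => [|z s IH] x Ax /=.
  by move=> _; exists [set x]; split=> //; [exact: connected1|move=> _ ->].
move=> [xz /(IH z)] [|X [cX XA Xz Xl]]; first exact/xz/segment_r.
exists (segment x z `|` X); split.
- apply: connectedU => //; last exact: connected_segment.
  by exists z; split=> //; exact: segment_r.
- by rewrite subUset.
- by left; exact: segment_l.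
- by right.
Qed.

(** This is the tube lemma, obtained from the near-covering form of compactness. *)
Lemma compact_proj_closed (S T : topologicalType) (K : set S) (Q : set (T * S)) :
  compact K -> closed Q -> closed [set b | exists2 k, K k & Q (b, k)].
Proof.
move=> /compact_near_coveringP cK cQ; rewrite -openC openE => b nb; rewrite /interior /=.
have : \forall b' \near b, forall k, K k -> ~ Q (b', k).
  apply: cK => k Kk.
  have : nbhs (b, k) (~` Q).
    by apply: open_nbhs_nbhs; split; [exact: closed_openC|move=> Qbk; apply: nb; exists k].
  move=> [[U V] /= [Ub Vk] UV]; exists (V, U) => // -[k' b'] /= [Vk' Ub'].
  exact: (UV (b', k')).
by apply: filterS => b' h [k Kk]; exact: h.
Qed.

End CompactConnected.

Section Watchman.
Context {R : realType} {n : nat} (v : 'I_n -> plane R) (hP : simple_polygon v).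
Implicit Types x y z u w d p q a b c : plane R.
Implicit Types W : set (plane R).

Local Notation P := (polygon_region v).

(* Otherwise some [y] seen from [p] is a limit of unseen points [b] which are linked
   to [W] by unseen points. The convex vertex below the chord of the line [p b]
   sees a point of [W] across this chord. In the limit, [W] has a point above the
   line [p y] seen from its chord, while [b] is below: the chord separates them. *)
Lemma watchman_sees p W : P p -> connected W -> compact W -> W `<=` P -> W !=set0 ->
  (forall j, convex_vertex v j -> exists2 w, W w & sees P (v j) w) ->
  exists2 w, W w & sees P p w.
Proof.
move=> Pp cW kW WP [w0 Ww0] Wv; apply: contrapT => nW'.
have nW w : W w -> ~ sees P p w by move=> Ww pw; apply: nW'; exists w.
have cP := @closed_region _ _ v.
have lsP := @region_locally_starshaped _ _ v.
have ssP x : P x -> sees P x x by move=> Px y /segmentP[t _ ->]; rewrite -scalerDl subrK scale1r.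
pose V := [set x | sees P p x].
have cV : closed V by exact: sees_l_closed.
pose D := P `\` V.
have lsD : locally_starshaped D by exact: locally_starshapedD.
have WD : W `<=` D by move=> w Ww; split; [exact: WP|exact: nW].
have Dw0 := WD _ Ww0.
pose K : set (plane R) := linked D w0.
have KD x : K x -> D x by exact: linked_mem.
have KW w : W w -> K w by move=> Ww; exact: (connected_linked lsD cW WD).
(* Otherwise [K] would be both open and closed relative to a connected subset of [P] joining [w0] to
   [p], although [p] is not in [K]. *)
have [y [Vy cKy]] : exists y, V y /\ closure K y.
  have [X [cX XP Xw0 Xp]] := linked_connected (WP _ Ww0) (region_linked (WP _ Ww0) Pp).
  apply: contrapT => ny.
  have XK y : X y -> closure K y -> K y.
    move=> Xy cKy; apply: contrapT => nKy.
    have Dy : D y by split; [exact: XP|move=> Vy; apply: ny; exists y].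
    have [z [Kz /(_ (KD _ Kz))]] := cKy _ (near_unlinked lsD Dy nKy).
    exact.
  have BX : X `&` K = X.
    apply: cX; first by exists w0; split=> //; exact: linked_refl.
      exists (interior [set z | D z -> K z] `&` ~` V).
        by apply: openI; [exact: open_interior|exact: closed_openC].
      apply/seteqP; split=> z [Xz]; last first.
        by move=> [/nbhs_singleton h nVz]; split=> //; apply: h; split=> //; exact: XP.
      move=> Kz; have Dz := KD _ Kz; split=> //; split; last by case: Dz.
      exact: near_linked.
    exists (closure K); first exact: closed_closure.
    apply/seteqP; split=> z [Xz h]; split=> //; first exact: subset_closure.
    exact: XK.
  have [_] : (X `&` K) p by rewrite BX.
  by move=> /KD[_]; apply; exact: ssP.
have Py : P y by apply: Vy; exact: segment_r.
pose k b := crossp (b - p) (y - p).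
(* [Z s] records what survives the limit: a chord point on the line from [p] to [b] that sees a
   point of the route weakly on side [s]. Weak inequality and compactness of [P] and [W] make it
   closed. *)
pose Z (s : R) : set (plane R) := [set b | exists2 cw : plane R * plane R, (P `*` W) cw &
   [/\ sees P cw.1 cw.2, sees P p cw.1, crossp (b - p) (cw.1 - p) = 0 &
       0 <= s * crossp (b - p) (cw.2 - p)]].
have cZ s : closed (Z s).
  apply: (@compact_proj_closed _ _ (P `*` W)
    [set bcw : plane R * (plane R * plane R) |
      [/\ sees P bcw.2.1 bcw.2.2, sees P p bcw.2.1, crossp (bcw.1 - p) (bcw.2.1 - p) = 0 &
       0 <= s * crossp (bcw.1 - p) (bcw.2.2 - p)]]).
    by apply: compact_setX => //; exact: compact_region.
  have c1 : continuous (fun b : plane R * (plane R * plane R) => b.1) by move=> b; exact: cvg_fst.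
  have c2 : continuous (fun b : plane R * (plane R * plane R) => b.2) by move=> b; exact: cvg_snd.
  have c21 : continuous (fun b : plane R * (plane R * plane R) => b.2.1).
    by move=> b; apply: (@continuous_comp _ _ _ snd fst); [exact: cvg_snd|exact: cvg_fst].
  have c22 : continuous (fun b : plane R * (plane R * plane R) => b.2.2).
    by move=> b; apply: (@continuous_comp _ _ _ snd snd); [exact: cvg_snd|exact: cvg_snd].
  have sh (f : plane R * (plane R * plane R) -> plane R) :
      continuous f -> continuous (fun e => f e - p).
    by move=> cf e; apply: continuousB; [exact: cf|exact: cvg_cst].
  have cr (f g : plane R * (plane R * plane R) -> plane R) : continuous f -> continuous g ->
      continuous (fun e => crossp (f e - p) (g e - p)).
    move=> cf cg e; apply: (crossp_cont (f := fun e => f e - p) (g := fun e => g e - p)).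
      exact: (sh f cf).
    exact: (sh g cg).
  have E1 : closed ((fun b : plane R * (plane R * plane R) => b.2) @^-1`
      [set xy : plane R * plane R | sees P xy.1 xy.2]).
    by apply: preimage_closed; [move=> b _; exact: c2|exact: sees_closed].
  have E2 : closed ((fun b : plane R * (plane R * plane R) => b.2.1) @^-1` V).
    by apply: preimage_closed => // b _; exact: c21.
  have E3 : closed ((fun b : plane R * (plane R * plane R) =>
      crossp (b.1 - p) (b.2.1 - p)) @^-1` [set t : R | t = 0]).
    by apply: preimage_closed; [move=> b _; exact: cr|exact: closed_eq].
  have E4 : closed ((fun b : plane R * (plane R * plane R) =>
      s * crossp (b.1 - p) (b.2.2 - p)) @^-1` [set t : R | 0 <= t]).
    apply: preimage_closed; last exact: closed_ge.
    move=> e _; apply: (@continuousM _ _ (fun=> s)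
      (fun b : plane R * (plane R * plane R) => crossp (b.1 - p) (b.2.2 - p)));
      first exact: cvg_cst.
    exact: cr.
  have := closedI E1 (closedI E2 (closedI E3 E4)).
  set X := (X in closed X); set Y := (X in _ -> closed X).
  suff -> : X = Y by [].
  by apply/seteqP; split=> e; [move=> [? [? [? ?]]]|move=> [? ? ? ?]].
pose Ks (s : R) : set (plane R) := [set b | [/\ K b, 0 < s * k b & Z s b]].
have KZ b : K b -> sees P y b -> Ks 1 b \/ Ks (-1) b.
  move=> Kb yb; have [Pb nVb] := KD _ Kb.
  have bp : b - p != 0.
    by rewrite subr_eq0; apply/eqP => bp; apply: nVb; rewrite bp; exact: ssP.
  have kb : k b != 0.
    apply/eqP => kb0; have [r yE] := crossp_line bp kb0.
    apply: nVb; have bE : b = p + 1 *: (b - p) by rewrite scale1r addrC subrK.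
    by rewrite /V /= {1}bE; apply: (@collinear_sees _ _ _ _ r); rewrite -?bE -yE.
  have main s : s != 0 -> 0 < s * k b -> Z s b.
    move=> s0 kbs; pose d := s *: (b - p).
    have d0 : d != 0 by rewrite scaler_eq0 negb_or s0.
    have dE x : crossp d x = s * crossp (b - p) x by rewrite /crossp !coordE; ring.
    have chV x : chord P p d x -> V x by case.
    have DC : D `<=` P `\` chord P p d by move=> x [Px nVx]; split=> // /chV.
    have hy : 0 < crossp d (y - p) by rewrite dE.
    have yb' : linked (P `\` chord P p d) b y.
      apply: linked_sym; apply: linked_seg => x yx; split; first exact: yb.
      move=> /[dup] /chV Vx /(chordP _ _ _ d0)[+ _].
      move: yx Vx => /segmentP[l l01 ->] Vx e.
      have : (1 - l) * crossp d (y - p) = 0.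
        by rewrite -[RHS]e /d /crossp !coordE; ring.
      move/eqP; rewrite mulf_eq0 subr_eq0 (gt_eqF hy) orbF => /eqP l1.
      by apply: nVb; move: Vx; rewrite -l1 subrr scale0r add0r scale1r.
    (* [w] is linked to [y] off the chord, whereas [v j] is on the chord or not so linked; hence the
       segment from [v j] to [w] meets the chord. *)
    have [j [cj jmin hj]] := convex_vertex_below hP Pp d0.
    have [w Ww jw] := Wv _ cj.
    have bw : linked (P `\` chord P p d) b w.
      by apply: sub_linked DC _; apply: linked_trans (linked_sym Kb) (KW _ Ww).
    have [c jc Cc] : exists2 c, segment (v j) w c & chord P p d c.
      case: hj => [Cj|hj]; first by exists (v j) => //; exact: segment_l.
      apply: contrapT => nc; apply: (hj y p hy (chord_refl d Pp) Vy).
      apply: linked_trans (linked_trans (linked_sym bw) yb').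
      by apply: linked_seg => x jx; split; [exact: jw|move=> Cx; apply: nc; exists x].
    have [cc Vc] := (chordP _ _ _ d0).1 Cc.
    exists (c, w); first by split=> //=; exact: jw.
    split => //=.
    - move: jc => /segmentP[l /andP[l0 l1] ->] x /segmentP[m /andP[m0 m1] ->].
      apply: jw; apply/segmentP; exists ((1 - m) * l + m).
        by clear -hP l0 l1 m0 m1; nra.
      by apply: plane_eq; rewrite !coordE; ring.
    - by move: cc; rewrite dE => /eqP; rewrite mulf_eq0 (negbTE s0) => /eqP.
    (* By [jmin], [w] is at least as high as [v j], hence as the point between them on the chord. *)
    - rewrite -dE leNgt; apply/negP => hw.
      have h1 := jmin _ jw.
      move: jc cc => /segmentP[l /andP[l0 l1] ->].
      have -> : crossp d ((1 - l) *: v j + l *: w - p) =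
         crossp d (w - p) - (1 - l) * (crossp d w - crossp d (v j)).
        by rewrite /crossp !coordE; ring.
      have : 0 <= (1 - l) * (crossp d w - crossp d (v j)) by rewrite mulr_ge0 ?subr_ge0.
      lra.
  have [h|h] : 0 < 1 * k b \/ 0 < -1 * k b.
    by case: (ltgtP 0 (k b)) kb => // h _; [left|right]; lra.
  - by left; split=> //; apply: main; rewrite ?oner_eq0.
  - by right; split=> //; apply: main; rewrite ?oppr_eq0 ?oner_eq0.
have ysee : \forall b \near y, P b -> sees P y b by exact: lsP.
have : closure (Ks 1 `|` Ks (-1)) y.
  move=> B By; have [b [Kb [Bb yb]]] := cKy _ (filterI By ysee).
  by exists b; split=> //; apply: KZ => //; apply: yb; case: (KD _ Kb).
have contra s : s != 0 -> closure (Ks s) y -> False.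
  move=> s0 cy.
  have Zy : Z s y by rewrite (closure_id (Z s)).1//; apply: closureS cy => b [].
  have [b [[Kb kb _] yb]] := cy _ ysee.
  have {}yb : sees P y b by apply: yb; case: (KD _ Kb).
  have [[c w] /= [Pc Ww] [cw pc cc cw0]] := Zy.
  pose d := s *: (y - p).
  have dE x : crossp d x = s * crossp (y - p) x by rewrite /crossp !coordE; ring.
  have d0 : d != 0.
    rewrite scaler_eq0 negb_or s0; apply/eqP => e; move: kb.
    by rewrite /k e /crossp /= !mulr0 subrr mulr0 ltxx.
  have Cc : chord P p d c by apply/chordP => //; rewrite dE cc mulr0.
  have Cy : chord P p d y.
    by apply/chordP => //; rewrite dE; split=> //; rewrite /crossp; ring.
  (* The strict inequality is regained: a [w] on the line would be seen from [p] through [c]. *)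
  have wpos : 0 < crossp d (w - p).
    rewrite lt_neqAle dE cw0 andbT eq_sym -dE; apply/eqP => e.
    have [t1 cE] := crossp_line d0 (proj1 ((chordP _ _ _ d0).1 Cc)).
    have [t2 wE] := crossp_line d0 e.
    apply: (nW _ Ww); rewrite wE; apply: (@collinear_sees _ _ _ _ t1); first by rewrite -cE.
    by rewrite -cE -wE.
  (* Exchanging [b] and [y] flips the sign: [y] above the line to [b] means [b] below the line to
     [y]. *)
  have bneg : crossp d (b - p) < 0.
    by rewrite dE crosspC mulrN oppr_lt0.
  apply: (chord_separates cP (@bounded_region _ _ v) (@filled_region _ _ v) Pp d0
    Cc wpos cw Cy bneg yb).
  apply: (@sub_linked _ D); first by move=> x [Px nVx]; split=> // -[].
  exact: linked_trans (linked_sym (KW _ Ww)) Kb.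
rewrite closureU => -[/contra|/contra]; apply; rewrite ?oppr_eq0 oner_eq0//.
Qed.

End Watchman.

(** * Hulls and cones *)

Section Convexity.
Context {R : realType}.
Implicit Types x y z u w d p q a b c : plane R.
Implicit Types P H X : set (plane R).

Lemma convex_segment (M : set (plane R)) x y : @convex_set R (plane R) M ->
  M x -> M y -> segment x y `<=` M.
Proof.
move=> cM Mx My z /segmentP[t t01 ->].
have t01' : 0 <= 1 - t <= 1 by lra.
have : M ((1 - t) *: x + (1 - (1 - t)) *: y).
  exact: set_mem (cM x y (Itv01 (proj1 (andP t01')) (proj2 (andP t01'))) (mem_set Mx) (mem_set My)).
by rewrite subKr.
Qed.

Lemma convex_combination3 (M : set (plane R)) p x y z (al be ga : R) :
  @convex_set R (plane R) M -> M x -> M y -> M z ->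
  0 <= al -> 0 <= be -> 0 <= ga -> 0 < al + be + ga ->
  al *: (x - p) + be *: (y - p) + ga *: (z - p) = 0 -> M p.
Proof.
move=> cM Mx My Mz a0 b0 g0 s0 e.
have pE : (al + be + ga) *: p = al *: x + be *: y + ga *: z.
  rewrite -[LHS]addr0 -[X in _ + X]e.
  by apply: plane_eq; rewrite !coordE; ring.
have sn : al + be + ga != 0 by rewrite gt_eqF.
have [bg|bg] := eqVneq (be + ga) 0.
  have -> : p = x; last by [].
  have [b1 g1] : be = 0 /\ ga = 0 by lra.
  by apply: (scalerI sn); rewrite pE b1 g1 !scale0r !addr0.
have bg0 : 0 < be + ga by rewrite lt_neqAle eq_sym bg addr_ge0.
have Mq : M ((1 - ga / (be + ga)) *: y + (ga / (be + ga)) *: z).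
  apply: (convex_segment cM My Mz); apply/segmentP; exists (ga / (be + ga)) => //.
  by rewrite divr_ge0 ?ler_pdivrMr ?mul1r//; lra.
apply: (convex_segment cM Mx Mq); apply/segmentP; exists ((be + ga) / (al + be + ga)).
  by rewrite divr_ge0 ?ler_pdivrMr ?mul1r//; lra.
apply: (scalerI sn); rewrite pE.
by apply: plane_eq; rewrite !coordE; field; apply/andP.
Qed.

(** The trivial partition bounds the length of any curve below by the distance of its ends, and
    along the segment every polyline sum telescopes to that distance. *)
Lemma sees_geodesic P a b : sees P a b ->
  geodesic P a b (fun t : R => (1 - t) *: a + t *: b).
Proof.
move=> ab; split.
  split; last 2 first.
  - by rewrite subr0 scale1r scale0r addr0.
  - by rewrite subrr scale1r scale0r add0r.
  split; first by apply: continuous_subspaceT => t; exact: seg_param_cont.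
  by move=> x [t t01 <-]; apply: ab; exists t.
move=> h [_ h0 h1].
apply: (@le_trans _ _ (enorm (b - a))%:E); last first.
  apply: ereal_sup_ubound => /=; exists [:: 1]; first by split=> //=; rewrite ltr01.
  by rewrite /polyline_length /= big_nat1 /= h0 h1.
apply: ge_ereal_sup => _ [s [ps ls] <-]; rewrite lee_fin /polyline_length.
set F := (X in X \o _).
have FE t t' : F t' - F t = (t' - t) *: (b - a).
  by rewrite /F; apply: plane_eq; rewrite !coordE; ring.
rewrite (eq_big_nat _ _ (F2 := fun m => (nth 1 (0 :: s) m.+1 - nth 1 (0 :: s) m) * enorm (b - a))).
  rewrite -mulr_suml telescope_sumr// -last_nth (eqP ls) /= subr0.
  by rewrite mul1r.
move=> m /andP[_ ms]; rewrite FE enormZ// subr_ge0 ltW//.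
by move/(pathP 1): ps => /(_ m ms).
Qed.

Lemma sub_relative_hull P X : X `<=` relative_hull P X.
Proof. by move=> x Xx H [_ XH]; exact: XH. Qed.

Lemma relative_hull_sub P X : X `<=` P -> relative_hull P X `<=` P.
Proof.
move=> XP x; apply; split=> //; split=> // p q g _ _ [[[_ gP] _ _] _]; exact: gP.
Qed.

Lemma relative_hull_sees P X x y : relative_hull P X x -> relative_hull P X y ->
  sees P x y -> segment x y `<=` relative_hull P X.
Proof.
move=> hx hy xy z /segmentP[t t01 zE] H [gH XH].
have [_ /(_ x y _ (hx H (conj gH XH)) (hy H (conj gH XH)) (sees_geodesic xy))] := gH.
by apply; exists t => //=; rewrite in_itv.
Qed.

Lemma dot_cross_eq0 q w : q != 0 -> dotp q w = 0 -> crossp q w = 0 -> w = 0.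
Proof.
move=> q0 h1 h2; have := lagrange_id q w; rewrite h1 h2 expr0n addr0 => /esym/eqP.
by rewrite mulf_eq0 !dotp_eq0 (negbTE q0) => /eqP.
Qed.

Lemma min_norm_dotp q w : (forall s, 0 <= s <= 1 ->
    dotp q q <= dotp ((1 - s) *: q + s *: w) ((1 - s) *: q + s *: w)) ->
  dotp q q <= dotp q w.
Proof.
move=> h; rewrite leNgt; apply/negP => lt.
set N := dotp q q in h lt; set D := dotp q w in lt.
pose L := dotp (w - q) (w - q).
have L0 : 0 <= L := dotp_ge0 _.
have e s : dotp ((1 - s) *: q + s *: w) ((1 - s) *: q + s *: w) =
    N - 2 * s * (N - D) + s ^+ 2 * L.
  by rewrite /N /D /L /dotp !coordE; ring.
(* The quadratic is least at [(N - D) / L]; the enlarged denominator is positive and keeps [s] at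
   most 1, while the value is still below [N]. *)
pose s := (N - D) / (N - D + L).
have den : 0 < N - D + L by lra.
have s0 : 0 < s by rewrite divr_gt0; lra.
have s1 : s <= 1 by rewrite ler_pdivrMr// mul1r; lra.
have := h s; rewrite e s1 ltW// => /(_ isT).
have : s * L <= N - D.
  by rewrite /s mulrAC ler_pdivrMr// ler_wpM2l//; lra.
have : 0 < s * (N - D) by rewrite mulr_gt0; lra.
nra.
Qed.

(* The signed coordinates [D = dotp q a], [mu], [eta], [xi] are taken along [q] and
   orthogonally to it; the sign [sg] selects the orientation. *)
Lemma planar_dependence_core q x y a (sg : R) : q != 0 -> sg ^+ 2 = 1 ->
  dotp q x = dotp q q -> dotp q y = dotp q q -> dotp q a <= 0 ->
  sg * crossp q y < 0 -> 0 < sg * crossp q x -> 0 <= sg * crossp q a ->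
  (forall s, 0 <= s <= 1 ->
    dotp q q <= dotp ((1 - s) *: y + s *: a) ((1 - s) *: y + s *: a)) ->
  exists al be ga : R, [/\ 0 <= al, 0 <= be, 0 < ga &
    al *: x + be *: y + ga *: a = 0].
Proof.
move=> q0 sg2 qx qy qa et0 xi0 mu0 hmin.
have N0 : 0 < dotp q q by rewrite lt_neqAle dotp_ge0 eq_sym dotp_eq0 q0.
set N := dotp q q in qx qy hmin N0.
set et := sg * crossp q y in et0.
set xi := sg * crossp q x in xi0.
set mu := sg * crossp q a in mu0.
set D := dotp q a in qa.
(* By Cramer's rule the coefficients are, up to sign, the 2 by 2 minors of the coordinates; only the
   sign of the first is in doubt. *)
have [al0|al0] := leP (mu * N) (D * et).
  exists (D * et - mu * N), (mu * N - D * xi), (N * (xi - et)); split.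
  - lra.
  - have : D * xi <= 0 by rewrite mulr_le0_ge0// ltW.
    have : 0 <= mu * N by rewrite mulr_ge0// ltW.
    lra.
  - by rewrite mulr_gt0//; lra.
  apply: (dot_cross_eq0 q0).
    transitivity ((D * et - mu * N) * dotp q x + (mu * N - D * xi) * dotp q y +
        N * (xi - et) * dotp q a).
      by rewrite /dotp !coordE; ring.
    by rewrite qx qy -/D; ring.
  have sgn : sg != 0 by apply: contra_eq_neq sg2 => ->; rewrite expr0n /= eq_sym oner_eq0.
  apply: (mulfI sgn); rewrite mulr0.
  transitivity ((D * et - mu * N) * (sg * crossp q x) + (mu * N - D * xi) * (sg * crossp q y) +
      N * (xi - et) * (sg * crossp q a)).
    by rewrite /crossp !coordE; ring.
  by rewrite -/xi -/et -/mu; ring.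
(* Here the segment from [y] to [a] crosses the ray of [q] at [ka *: q] with [0 < ka < 1], closer to
   0 than [q]; [s] is the zero of the coordinate orthogonal to [q]. *)
exfalso.
have me : 0 < mu - et by lra.
pose s := - et / (mu - et).
have s0 : 0 <= s by rewrite divr_ge0//; lra.
have s1 : s <= 1 by rewrite ler_pdivrMr// mul1r; lra.
pose ka := (mu * N - D * et) / ((mu - et) * N).
have den : 0 < (mu - et) * N by rewrite mulr_gt0.
have k0 : 0 < ka by rewrite divr_gt0; lra.
have k1 : ka < 1.
  rewrite ltr_pdivrMr// mul1r.
  have : 0 <= D * et by rewrite mulr_le0// ltW.
  have : et * N < 0 by rewrite pmulr_llt0.
  lra.
have sE : (1 - s) *: y + s *: a = ka *: q.
  apply/eqP; rewrite -subr_eq0; apply/eqP; apply: (dot_cross_eq0 q0).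
    transitivity ((1 - s) * dotp q y + s * dotp q a - ka * N).
      by rewrite /N /dotp !coordE; ring.
    by rewrite qy -/D /ka /s; field; rewrite !gt_eqF.
  have sgn : sg != 0 by apply: contra_eq_neq sg2 => ->; rewrite expr0n /= eq_sym oner_eq0.
  apply: (mulfI sgn); rewrite mulr0.
  transitivity ((1 - s) * (sg * crossp q y) + s * (sg * crossp q a)).
    by rewrite /crossp !coordE; ring.
  by rewrite -/et -/mu /s; field; rewrite gt_eqF.
have := hmin s; rewrite s0 s1 sE => /(_ isT).
have -> : dotp (ka *: q) (ka *: q) = ka ^+ 2 * N by rewrite /N /dotp !coordE; ring.
have : ka ^+ 2 < 1 by rewrite expr_lt1// ltW.
move=> k2; rewrite leNgt => /negP; apply.
by rewrite gtr_pMl.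
Qed.

(* Take the point [q] of least norm on the segments with both ends in [A]. If [q]
   is not [0] and [dotp q a <= 0], then [0] lies in the triangle spanned by [a] and
   the ends of the segment through [q], as one of the other two sides would
   otherwise come closer to [0] than [q]. *)
Lemma planar_dependence (A : set (plane R)) : compact A -> A !=set0 ->
  (forall f : plane R, f != 0 -> exists2 a, A a & dotp f a <= 0) ->
  exists x y z (al be ga : R), [/\ A x, A y & A z] /\
   [/\ 0 <= al, 0 <= be, 0 <= ga, 0 < al + be + ga & al *: x + be *: y + ga *: z = 0].
Proof.
move=> cA [a0 Aa0] hA.
pose g (e : (plane R * plane R) * R) : plane R := (1 - e.2) *: e.1.1 + e.2 *: e.1.2.
have cg : continuous (fun e => dotp (g e) (g e)).
  have c1 : continuous (fun e : (plane R * plane R) * R => e.1.1).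
    by move=> e; apply: (@continuous_comp _ _ _ fst fst); [exact: cvg_fst|exact: cvg_fst].
  have c2 : continuous (fun e : (plane R * plane R) * R => e.1.2).
    by move=> e; apply: (@continuous_comp _ _ _ fst snd); [exact: cvg_fst|exact: cvg_snd].
  have c3 : continuous (fun e : (plane R * plane R) * R => e.2).
    by move=> e; exact: cvg_snd.
  have cg : continuous g.
    move=> e; apply: (@continuousD _ _ _ (fun e : (plane R * plane R) * R => (1 - e.2) *: e.1.1)
       (fun e : (plane R * plane R) * R => e.2 *: e.1.2)).
      apply: cvgZ; last exact: c1.
      by apply: cvgB; [exact: cvg_cst|exact: c3].
    by apply: cvgZ; [exact: c3|exact: c2].
  by move=> e; apply: (dotp_cont (f := g) (g := g)); exact: cg.
pose K := (A `*` A) `*` (`[0, 1]%classic : set R).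
have cK : compact K by apply: compact_setX; [exact: compact_setX|exact: segment_compact].
have K0 : K ((a0, a0), 0) by split=> //=; rewrite in_itv /= lexx ler01.
have [[[x y] t] /set_mem[[/= Ax Ay] t01] hmin] :=
  @compact_EVT_min _ _ _ K (ex_intro _ _ K0) cK (continuous_subspaceT cg).
rewrite in_itv /= in t01.
pose q := (1 - t) *: x + t *: y.
have {}hmin x' y' t' : A x' -> A y' -> 0 <= t' <= 1 ->
    dotp q q <= dotp ((1 - t') *: x' + t' *: y') ((1 - t') *: x' + t' *: y').
  move=> Ax' Ay' t'01; apply: (hmin ((x', y'), t')); apply: mem_set.
  by split=> //=; rewrite in_itv.
have [q0|q0] := eqVneq q 0.
  exists x, y, y, (1 - t), t, 0; split=> //; split; rewrite ?subr_ge0 ?addr0 ?subrK ?ltr01//.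
  - by case/andP: t01.
  - by case/andP: t01.
  - by rewrite scale0r addr0.
have N0 : 0 < dotp q q by rewrite lt_neqAle dotp_ge0 eq_sym dotp_eq0 q0.
have [a Aa qa] := hA q q0.
have qnA : ~ A q.
  move=> Aq; have : dotp q q <= dotp q a by apply: min_norm_dotp => s s01; exact: hmin.
  lra.
have tn0 : t != 0 by apply: contra_notN qnA => /eqP t0; rewrite /q t0 subr0 scale1r scale0r addr0.
have tn1 : t != 1 by apply: contra_notN qnA => /eqP t1; rewrite /q t1 subrr scale1r scale0r add0r.
have [t0 t1] : 0 < t /\ t < 1.
  by move: t01 => /andP[h1 h2]; split; rewrite lt_neqAle ?tn1// eq_sym tn0.
have qx0 : dotp q q <= dotp q x.
  apply: min_norm_dotp => s /andP[s0 s1].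
  have -> : (1 - s) *: q + s *: x = (1 - (1 - s) * t) *: x + ((1 - s) * t) *: y.
    by rewrite /q; apply: plane_eq; rewrite !coordE; ring.
  by apply: hmin => //; clear -s0 s1 t0 t1; nra.
have qy0 : dotp q q <= dotp q y.
  apply: min_norm_dotp => s /andP[s0 s1].
  have -> : (1 - s) *: q + s *: y = (1 - ((1 - s) * t + s)) *: x + ((1 - s) * t + s) *: y.
    by rewrite /q; apply: plane_eq; rewrite !coordE; ring.
  by apply: hmin => //; clear -s0 s1 t0 t1; nra.
(* A weighted sum of two nonnegative excesses is 0, so both vanish: the segment from [x] to [y] is
   orthogonal to [q]. *)
have sumD : (1 - t) * (dotp q x - dotp q q) + t * (dotp q y - dotp q q) = 0.
  by rewrite /q /dotp !coordE; ring.
have sumC : (1 - t) * crossp q x + t * crossp q y = 0.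
  by rewrite /q /crossp !coordE; ring.
have t1' : 0 < 1 - t by lra.
have p1 : 0 <= (1 - t) * (dotp q x - dotp q q) by rewrite mulr_ge0 ?subr_ge0// ltW.
have p2 : 0 <= t * (dotp q y - dotp q q) by rewrite mulr_ge0 ?subr_ge0// ltW.
have e1 : (1 - t) * (dotp q x - dotp q q) = 0 by lra.
have e2 : t * (dotp q y - dotp q q) = 0 by lra.
have qx : dotp q x = dotp q q.
  by apply/eqP; move/eqP: e1; rewrite mulf_eq0 (gt_eqF t1') subr_eq0.
have qy : dotp q y = dotp q q.
  by apply/eqP; move/eqP: e2; rewrite mulf_eq0 (gt_eqF t0) subr_eq0.
have cx0 : crossp q x != 0.
  apply: contra_notN qnA => /eqP cx.
  have <- : x = q; last by [].
  apply/eqP; rewrite -subr_eq0; apply/eqP/(dot_cross_eq0 q0).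
    by rewrite -[RHS](subrr (dotp q q)) -{1}qx /dotp !coordE; ring.
  by rewrite -[RHS]cx /crossp !coordE; ring.
have cyE : crossp q y = - ((1 - t) / t * crossp q x).
  apply: (mulfI tn0); rewrite mulrN mulrA mulrC.
  by rewrite (_ : t * ((1 - t) / t) = 1 - t); [lra|field].
have r0 : 0 < (1 - t) / t by rewrite divr_gt0.
have opp : crossp q x * crossp q y < 0.
  have : 0 < crossp q x ^+ 2 by rewrite lt_neqAle eq_sym sqrf_eq0 cx0 sqr_ge0.
  move=> h; rewrite cyE mulrN oppr_lt0 mulrCA mulr_gt0//.
have core x' y' (sg : R) : A x' -> A y' -> sg ^+ 2 = 1 ->
    dotp q x' = dotp q q -> dotp q y' = dotp q q ->
    sg * crossp q y' < 0 -> 0 < sg * crossp q x' -> 0 <= sg * crossp q a ->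
    exists x y z (al be ga : R), [/\ A x, A y & A z] /\
    [/\ 0 <= al, 0 <= be, 0 <= ga, 0 < al + be + ga & al *: x + be *: y + ga *: z = 0].
  move=> Ax' Ay' s2 h1 h2 h3 h4 h5.
  have [al [be [ga [al0 be0 ga0 e]]]] := planar_dependence_core q0 s2 h1 h2 qa h3 h4 h5
    (fun s s01 => hmin y' a s Ay' Aa s01).
  by exists x', y', a, al, be, ga; split=> //; split=> //; lra.
have s1 : (1 : R) ^+ 2 = 1 by rewrite expr1n.
have sN1 : (-1 : R) ^+ 2 = 1 by rewrite sqrrN expr1n.
have [ca|ca] := leP 0 (crossp q a); have [cx|cx] := ltP 0 (crossp q x).
- have cy : crossp q y < 0 by move: opp; rewrite pmulr_rlt0.
  by apply: (core x y 1); rewrite ?mul1r.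
- have {}cx : crossp q x < 0 by rewrite lt_neqAle cx0.
  have cy : 0 < crossp q y by move: opp; rewrite nmulr_rlt0.
  by apply: (core y x 1); rewrite ?mul1r.
- have cy : crossp q y < 0 by move: opp; rewrite pmulr_rlt0.
  by apply: (core y x (-1)); rewrite ?mulN1r ?oppr_lt0 ?oppr_gt0 ?oppr_ge0// ltW.
- have {}cx : crossp q x < 0 by rewrite lt_neqAle cx0.
  have cy : 0 < crossp q y by move: opp; rewrite nmulr_rlt0.
  by apply: (core x y (-1)); rewrite ?mulN1r ?oppr_lt0 ?oppr_gt0 ?oppr_ge0// ltW.
Qed.

End Convexity.

Section Cone.
Context {R : realType} {n : nat} (v : 'I_n -> plane R).
Implicit Types x y z u w d p q a b c : plane R.
Implicit Types W : set (plane R).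

Local Notation P := (polygon_region v).

Lemma trace_connected (g : R -> plane R) : {within `[0, 1], continuous g} -> connected (trace g).
Proof. by move=> cg; apply: connected_continuous_connected => //; exact: segment_connected. Qed.

Lemma trace_compact (g : R -> plane R) : {within `[0, 1], continuous g} -> compact (trace g).
Proof. by move=> cg; apply: continuous_compact => //; exact: segment_compact. Qed.

Lemma trace_nonempty (g : R -> plane R) : trace g !=set0.
Proof. by exists (g 0), 0 => //=; rewrite in_itv /= lexx ler01. Qed.

(* The directions in which [p] sees a point of [W] form a convex cone: along
   a segment between two of them, every line through [p] meets [W] on exactly
   one side, and the side cannot change. *)
Lemma seen_cone p W x y (al be : R) : P p -> connected W -> compact W -> W `<=` P ->
  (forall a b, W a -> W b -> sees P p a -> sees P p b -> ~ segment a b p) ->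
  W x -> sees P p x -> W y -> sees P p y -> 0 <= al -> 0 <= be -> 0 < al + be ->
  exists z (la : R), [/\ W z, sees P p z, 0 < la &
    z - p = la *: (al *: (x - p) + be *: (y - p))].
Proof.
move=> Pp cW kW WP anti Wx px Wy py al0 be0 s0.
have cP := @closed_region _ _ v.
pose A := W `&` [set w | sees P p w].
have kA : compact A by apply: compact_closedI => //; exact: sees_l_closed.
have Ap a : A a -> a != p.
  by move=> [Wa pa]; apply/eqP => e; apply: (anti a a) => //; rewrite e; exact: segment_l.
(* For [E 1] the line from [p] to [q] meets the seen part of [W] on the side of [q], for [E (-1)] on
   the opposite side. Both are closed, and on the connected segment they are disjoint and
   exhaustive. *)
pose E (s : R) : set (plane R) := [set q | exists2 z, A z &
  crossp (q - p) (z - p) = 0 /\ 0 <= s * dotp (q - p) (z - p)].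
have cE s : closed (E s).
  apply: (@compact_proj_closed _ _ A [set e : plane R * plane R |
    crossp (e.1 - p) (e.2 - p) = 0 /\ 0 <= s * dotp (e.1 - p) (e.2 - p)]) => //.
  have c1 : continuous (fun e : plane R * plane R => e.1 - p).
    by move=> e; apply: continuousB; [exact: cvg_fst|exact: cvg_cst].
  have c2 : continuous (fun e : plane R * plane R => e.2 - p).
    by move=> e; apply: continuousB; [exact: cvg_snd|exact: cvg_cst].
  have E1 : closed ((fun e : plane R * plane R => crossp (e.1 - p) (e.2 - p)) @^-1`
       [set t : R | t = 0]).
    apply: preimage_closed; last exact: closed_eq.
    move=> e _; apply: (crossp_cont (f := fun e : plane R * plane R => e.1 - p)
      (g := fun e : plane R * plane R => e.2 - p)).
      exact: c1.
    exact: c2.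
  have E2 : closed ((fun e : plane R * plane R => s * dotp (e.1 - p) (e.2 - p)) @^-1`
       [set t : R | 0 <= t]).
    apply: preimage_closed; last exact: closed_ge.
    move=> e _; apply: (@continuousM _ _ (fun=> s)
      (fun e : plane R * plane R => dotp (e.1 - p) (e.2 - p))); first exact: cvg_cst.
    apply: (dotp_cont (f := fun e : plane R * plane R => e.1 - p)
      (g := fun e : plane R * plane R => e.2 - p)).
      exact: c1.
    exact: c2.
  exact: closedI E1 E2.
have qp q : segment x y q -> q - p != 0.
  by move=> xyq; rewrite subr_eq0; apply/eqP => e; apply: (anti x y) => //; rewrite -e.
have line q z : segment x y q -> A z -> crossp (q - p) (z - p) = 0 ->
    exists2 la : R, la != 0 & z = p + la *: (q - p) /\ (0 < la) = (0 <= dotp (q - p) (z - p)).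
  move=> xyq Az h; have [la zE] := crossp_line (qp q xyq) h.
  have la0 : la != 0.
    by apply: contra_neq (Ap _ Az) => e; rewrite zE e scale0r addr0.
  exists la => //; split=> //.
  have -> : dotp (q - p) (z - p) = la * dotp (q - p) (q - p).
    by rewrite {1}zE /dotp !coordE; ring.
  have N : 0 < dotp (q - p) (q - p) by rewrite lt_neqAle dotp_ge0 eq_sym dotp_eq0 qp.
  by rewrite pmulr_lge0// le_eqVlt eq_sym (negbTE la0).
have disj q : segment x y q -> E 1 q -> E (-1) q -> False.
  move=> xyq [z Az [cz dz]] [z' Az' [cz' dz']].
  have [la la0 [zE laE]] := line q z xyq Az cz.
  have [la' la0' [zE' laE']] := line q z' xyq Az' cz'.
  rewrite mul1r in dz; rewrite dz in laE.
  have lan : la' < 0.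
    rewrite ltNge le_eqVlt eq_sym (negbTE la0') laE' -ltNge lt_neqAle.
    rewrite mulN1r oppr_ge0 in dz'; rewrite dz' andbT zE'.
    have -> : dotp (q - p) (p + la' *: (q - p) - p) = la' * dotp (q - p) (q - p).
      by rewrite /dotp !coordE; ring.
    by rewrite mulf_neq0// dotp_eq0 qp.
  case: Az => Wz pz; case: Az' => Wz' pz'.
  apply: (anti z z' Wz Wz' pz pz'); rewrite zE zE'.
  have : segment (p + la *: (q - p)) (p + la' *: (q - p)) (p + 0 *: (q - p)).
    by apply: line_segment; right; rewrite !ltW.
  by rewrite scale0r addr0.
(* If the line met no seen point, [W] would avoid the chord in direction [q - p], which separates
   [x] from [y]. *)
have cover q : segment x y q -> exists2 z, A z & crossp (q - p) (z - p) = 0.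
  move=> xyq; have /segmentP[t /andP[t0 t1] qE] := xyq.
  have cqx : crossp (q - p) (x - p) = - (t * crossp (x - p) (y - p)).
    by rewrite qE /crossp !coordE; ring.
  have cqy : crossp (q - p) (y - p) = (1 - t) * crossp (x - p) (y - p).
    by rewrite qE /crossp !coordE; ring.
  apply: contrapT => nz.
  have nA z : A z -> crossp (q - p) (z - p) != 0.
    by move=> Az; apply/eqP => h; apply: nz; exists z.
  have Cx : crossp (q - p) (x - p) != 0 by apply: nA.
  have Cy : crossp (q - p) (y - p) != 0 by apply: nA.
  have d0 := qp q xyq.
  have cC : closed (chord P p (q - p)) by exact: closed_chord.
  have lsD := locally_starshapedD (@region_locally_starshaped _ _ v) cC.
  have WD : W `<=` P `\` chord P p (q - p).
    move=> w Ww; split; [exact: WP|move=> /(chordP _ _ _ d0)[cw pw]].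
    by have := nA w (conj Ww pw); rewrite cw eqxx.
  have xy := connected_linked lsD cW WD Wx Wy.
  have pC := chord_refl (q - p) Pp.
  have sep := @chord_separates _ _ p (q - p) _ _ p p cP
    (@bounded_region _ _ v) (@filled_region _ _ v) Pp d0 pC.
  have t0' : t != 0 by apply: contra_neq Cx => t00; rewrite cqx t00 mul0r oppr0.
  have t1' : 1 - t != 0 by apply: contra_neq Cy => t00; rewrite cqy t00 mul0r.
  have tp : 0 < t by rewrite lt_neqAle eq_sym t0'.
  have t1p : 0 < 1 - t by rewrite lt_neqAle eq_sym t1' subr_ge0.
  have [h|h|h] := ltgtP 0 (crossp (x - p) (y - p)).
  - apply: (sep y x _ py pC _ px (linked_sym xy)).
      by rewrite cqy mulr_gt0.
    by rewrite cqx oppr_lt0 mulr_gt0.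
  - apply: (sep x y _ px pC _ py xy).
      by rewrite cqx oppr_gt0 pmulr_rlt0.
    by rewrite cqy pmulr_rlt0.
  - by move: Cy; rewrite cqy -h mulr0 eqxx.
have side q : segment x y q -> E 1 q \/ E (-1) q.
  move=> /cover[z Az cz]; have [h|h] := leP 0 (dotp (q - p) (z - p)).
    by left; exists z => //; rewrite mul1r.
  by right; exists z => //; split=> //; rewrite mulN1r oppr_ge0 ltW.
have allE q : segment x y q -> E 1 q.
  have BX : segment x y `&` E 1 = segment x y.
    apply: (connected_segment (x := x) (y := y)).
    - exists x; split; first exact: segment_l.
      exists x; first by split.
      by split; [rewrite /crossp; ring|rewrite mul1r dotp_ge0].
    - exists (~` E (-1)); first exact: closed_openC.
      apply/seteqP; split=> r [xyr]; first by move=> E1; split=> // /(disj _ xyr E1).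
      by case: (side _ xyr) => // h1 [].
    - by exists (E 1).
  by rewrite -{1}BX => -[].
pose t := be / (al + be).
pose q := (1 - t) *: x + t *: y.
have sn : al + be != 0 by rewrite gt_eqF.
have xyq : segment x y q.
  by apply/segmentP; exists t => //; rewrite divr_ge0 ?ler_pdivrMr ?mul1r//; lra.
have [z Az [cz dz]] := allE _ xyq.
have [la la0 [zE laE]] := line q z xyq Az cz.
rewrite mul1r in dz; rewrite dz in laE.
have [Wz pz] := Az.
exists z, (la / (al + be)); split=> //; first by rewrite divr_gt0.
rewrite zE addrC addKr -scalerA; congr (_ *: _).
by rewrite /q /t; apply: plane_eq; rewrite !coordE; field.
Qed.

End Cone.

(** * One guard on each route *)

Section Main.
Context {R : realType} {n : nat} (v : 'I_n -> plane R).
Implicit Types x y z u w d p q a b c : plane R.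

Local Notation P := (polygon_region v).

(** Each route contributes a single point, hence the conditions for coinciding indices; all routes
    not named stand at [w0] with weight 0. *)
Lemma hull_guarded_combination k (W : 'I_k -> set (plane R)) p (w0 : 'I_k -> plane R)
    (i j l : 'I_k) x y z (al be ga : R) :
  (forall i, W i (w0 i) /\ sees P p (w0 i)) ->
  W i x -> sees P p x -> W j y -> sees P p y -> W l z -> sees P p z ->
  (j = i -> y = x) -> (l = i -> z = x) -> (l = j -> z = y) ->
  0 <= al -> 0 <= be -> 0 <= ga -> 0 < al + be + ga ->
  al *: (x - p) + be *: (y - p) + ga *: (z - p) = 0 ->
  exists2 w, forall i, W i (w i) & hull_guarded P w p.
Proof.
move=> hw0 Wx px Wy py Wz pz yx zx zy al0 be0 ga0 s0 e.
pose w m := if m == i then x else if m == j then y else if m == l then z else w0 m.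
have hw m : W m (w m) /\ sees P p (w m).
  rewrite /w; case: eqVneq => [->//|_]; case: eqVneq => [->//|_].
  by case: eqVneq => [->//|_].
have wi : w i = x by rewrite /w eqxx.
have wj : w j = y by rewrite /w; case: eqVneq => [/yx->//|_]; rewrite eqxx.
have wl : w l = z.
  rewrite /w; case: eqVneq => [/zx->//|_]; case: eqVneq => [/zy->//|_].
  by rewrite eqxx.
exists w; first by move=> m; case: (hw m).
split.
- by move=> m; case: (hw m) => _; apply; exact: segment_r.
- move=> M [cM hM]; apply: (convex_combination3 cM _ _ _ al0 be0 ga0 s0 e); apply: hM.
  + by exists i.
  + by exists j.
  + by exists l.
- by move=> m; rewrite /sees segmentC; case: (hw m).
Qed.

(** The ray leaves the closure of [H] at a frontier point, and up to there it stays in [P] because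
    [P] is closed. *)
Lemma interior_opposite p d (H : set (plane R)) : H `<=` P -> interior H p -> d != 0 ->
  exists2 x, frontier H x & sees P p x /\ exists2 t : R, 0 <= t & x = p + t *: d.
Proof.
move=> HP ip d0.
have cHP : closure H `<=` P.
  by rewrite [X in _ `<=` X](closure_id P).1; [exact: closureS|exact: closed_region].
have [M [Mr hM]] := @bounded_region _ _ v.
have bH : bounded_set (closure H) by exists M; split=> // N /hM h x /cHP; exact: h.
have Hp : closure H p by apply: subset_closure; exact: interior_subset.
have [tau [tau0 tauH] tauE] := exit_param (@closed_closure _ H) bH Hp d0.
exists (p + tau *: d).
  split; first by apply: tauH; rewrite tau0 lexx.
  move=> ix; have : nbhs tau ((fun t : R => p + t *: d) @^-1` H).
    by exact: (line_cont (p := p) (d := d)).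
  move=> /nbhs_ballP[e /= e0 he]; have [s hs nHs] := tauE _ e0.
  apply: nHs; apply: subset_closure; apply: he; rewrite -ball_normE /= ltr_norml; lra.
split; last by exists tau.
move=> x /segmentP[l /andP[l0 l1] ->].
have -> : (1 - l) *: p + l *: (p + tau *: d) = p + (l * tau) *: d.
  by apply: plane_eq; rewrite !coordE; ring.
by apply/cHP/tauH; rewrite mulr_ge0//= ler_piMl.
Qed.

End Main.

Unset Implicit Arguments.
Set Strict Implicit.
Set Printing Implicit Defensive.

Theorem lemma16 (R : realType) (n : nat) (v : 'I_n -> plane R)
    (hP : simple_polygon v) (k : nat) (hk : (2 <= k)%N)
    (W : 'I_k -> R -> plane R)
    (hW : forall i : 'I_k, route (polygon_region v) (W i))
    (h_i : forall j : 'I_n, convex_vertex v j ->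
       exists i : 'I_k, visits_point (W i) (v j))
    (h_ii : forall j : 'I_n, convex_vertex v j ->
       forall i : 'I_k,
         visits_set (W i) (visibility_polygon (polygon_region v) (v j)))
    (h_iii : forall i : 'I_k, relatively_convex (polygon_region v) (W i)) :
  hull_watchman_routes (polygon_region v) W.
Proof.
move=> p Pp.
set P := polygon_region v in Pp *.
pose T i := trace (W i).
have cT i : connected (T i) by apply: trace_connected; case: (hW i) => -[].
have kT i : compact (T i) by apply: trace_compact; case: (hW i) => -[].
have TP i : T i `<=` P by case: (hW i) => -[].
have seen i : exists w, T i w /\ sees P p w.
  have [w Tw pw] : exists2 w, T i w & sees P p w.
    apply: (watchman_sees hP Pp (cT i) (kT i) (TP i) (trace_nonempty _)) => j /h_ii /(_ i).
    by move=> [w [Tw [_ jw]]]; exists w.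
  by exists w.
have [w0 hw0] := choice seen.
have pp : sees P p p by move=> y /segmentP[t _ ->]; rewrite -scalerDl subrK scale1r.
have combine := hull_guarded_combination hw0.
have [[i Tp]|nTp] := pselect (exists i, T i p).
  apply: (combine i i i p p p 1 0 0) => //; rewrite ?lexx ?ler01 ?addr0 ?ltr01//.
  by rewrite subrr !scaler0 !addr0.
pose H i := relative_hull P (T i).
have fH i : T i = frontier (H i) by exact: h_iii.
have HP i : H i `<=` P by apply: relative_hull_sub.
(* [hk] provides another route with a seen point; in the opposite direction the frontier of the
   hull, which is route [i] itself, supplies the second one. *)
have [[i ip]|nip] := pselect (exists i, interior (H i) p).
  have [j ji] : exists j, j != i.
    have k0 : (0 < k)%N by apply: leq_trans hk.
    have [i0|i0] := eqVneq (val i) 0%N; last by exists (Ordinal k0); rewrite -val_eqE /= eq_sym.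
    by exists (Ordinal hk); rewrite -val_eqE /= i0.
  have [Twj pwj] := hw0 j.
  have d0 : p - w0 j != 0.
    by rewrite subr_eq0; apply/eqP => e; apply: nTp; exists j; rewrite e.
  have [x fx [px [t t0 xE]]] := interior_opposite (HP i) ip d0.
  rewrite -fH in fx.
  have ij : (i = j) -> False by move=> e; rewrite e eqxx in ji.
  apply: (combine j i i (w0 j) x x t 1 0) => //.
  - by rewrite addr0 ltr_wpDl.
  - by rewrite xE; apply: plane_eq; rewrite !coordE; ring.
have ncl i : ~ closure (H i) p.
  move=> cp; apply: nTp; exists i; rewrite fH; split=> // ip; apply: nip.
  by exists i.
have anti i a b : T i a -> T i b -> sees P p a -> sees P p b -> ~ segment a b p.
  move=> Ta Tb pa pb abp; apply: (ncl i); apply: subset_closure.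
  have ab : sees P a b.
    have /segmentP[t t01 pE] := abp.
    have e1 : p = a + t *: (b - a) by rewrite pE; apply: plane_eq; rewrite !coordE; ring.
    have e2 : b = a + 1 *: (b - a) by rewrite scale1r addrC subrK.
    rewrite /sees {1}e2; apply: (@collinear_sees _ _ _ _ t); rewrite -e1.
      by rewrite /sees segmentC.
    by rewrite -e2.
  exact: (relative_hull_sees (sub_relative_hull Ta) (sub_relative_hull Tb) ab).
pose A : set (plane R) := \bigcup_i (T i `&` [set w | sees P p w]).
have cP : closed P by exact: closed_region.
have kA : compact A.
  apply: (@subclosed_compact _ _ P); [|exact: compact_region|by move=> x [i _ [/TP]]].
  apply: closed_bigcup => [|i _]; first exact: finite_finset.
  apply: closedI; last exact: sees_l_closed.
  by apply: compact_closed => //; exact: norm_hausdorff.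
have kA' : compact ((fun x => x - p) @` A).
  apply: continuous_compact => //; apply: continuous_subspaceT => x.
  by apply: continuousB; [exact: cvg_id|exact: cvg_cst].
have [j0 _] : exists j : 'I_k, True by exists (Ordinal hk).
have A0 : (fun x => x - p) @` A !=set0.
  by exists (w0 j0 - p), (w0 j0) => //; exists j0 => //; exact: hw0.
have nosep f : f != 0 -> exists2 a, ((fun x => x - p) @` A) a & dotp f a <= 0.
  move=> f0; apply: contrapT => nf.
  have pos i w : T i w -> sees P p w -> 0 < dotp f (w - p).
    move=> Tw pw; rewrite ltNge; apply/negP => h; apply: nf.
    by exists (w - p) => //; exists w => //; exists i.
  (* [d] is [f] turned by a right angle, so that [crossp d] equals [dotp f] and the chord is the
     seen part of the separating line. *)
  pose d : plane R := (f.2, - f.1).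
  have df w : crossp d w = dotp f w by rewrite /crossp /dotp /d /=; ring.
  have d0 : d != 0.
    apply: contra_neq f0 => /eqP; rewrite /d xpair_eqE oppr_eq0 => /andP[/eqP h1 /eqP h2].
    exact: plane_eq.
  have [j [cj _ hj]] := convex_vertex_below hP Pp d0.
  have [i Tj] := h_i _ cj.
  have nC w : T i w -> ~ chord P p d w.
    move=> Tw /(chordP _ _ _ d0)[cw pw]; have := pos _ _ Tw pw.
    by rewrite -df cw ltxx.
  case: hj => [/nC|hj]; first exact.
  have [Tw pw] := hw0 i.
  apply: (hj (w0 i) p _ (chord_refl d Pp) pw).
    by rewrite df; exact: (pos i).
  have cC : closed (chord P p d) by exact: closed_chord.
  apply: (connected_linked _ (cT i)) => //.
    exact: locally_starshapedD (@region_locally_starshaped _ _ v) cC.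
  by move=> w Tw'; split; [exact: (TP i)|exact: nC].
have [x' [y' [z' [al [be [ga [[Ax' Ay' Az'] [al0 be0 ga0 s0 e]]]]]]]] :=
  planar_dependence kA' A0 nosep.
move: Ax' Ay' Az' e => [x [i _ [Tx px]] <-] [y [j _ [Ty py]] <-] [z [l _ [Tz pz]] <-] e.
have antiV i' a b (s t : R) : T i' a -> T i' b -> sees P p a -> sees P p b ->
    0 <= s -> 0 <= t -> 0 < s + t ->
    s *: (a - p) + t *: (b - p) = 0 -> False.
  move=> Ta Tb pa pb sp tp st0 h; apply: (anti i' a b) => //.
  have stn : s + t != 0 by rewrite gt_eqF.
  apply/segmentP; exists (t / (s + t)).
    by rewrite divr_ge0 ?ler_pdivrMr ?mul1r//; lra.
  apply: (scalerI stn); rewrite -[LHS]addr0 -h.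
  by apply: plane_eq; rewrite !coordE; field.
(* The two points on route [i'] are replaced by one seen point of it in the direction of their
   combination. If the third point is on that route as well, [antiV] yields a contradiction. *)
have merge (i' l' : 'I_k) (a b c : plane R) (s t r : R) :
    T i' a -> sees P p a -> T i' b -> sees P p b ->
    T l' c -> sees P p c -> 0 <= s -> 0 <= t -> 0 <= r -> 0 < s + t + r ->
    s *: (a - p) + t *: (b - p) + r *: (c - p) = 0 ->
    exists2 w : 'I_k -> plane R, forall i, T i (w i) & hull_guarded P w p.
  move=> Ta pa Tb pb Tc pc sp tp rp str0 h.
  have cp : c - p != 0.
    by rewrite subr_eq0; apply/eqP => cp; apply: nTp; exists l'; rewrite -cp.
  have st0 : 0 < s + t.
    rewrite lt_neqAle addr_ge0// andbT eq_sym; apply/eqP => st.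
    have [s00 t00] : s = 0 /\ t = 0 by lra.
    move: h; rewrite s00 t00 !scale0r !add0r => /eqP.
    rewrite scaler_eq0 (negbTE cp) orbF => /eqP r00.
    by move: str0; rewrite s00 t00 r00 !addr0 ltxx.
  have [q [la [Tq pq la0 qE]]] :=
    seen_cone Pp (cT i') (kT i') (TP i') (anti i') Ta pa Tb pb sp tp st0.
  have h' : 1 *: (q - p) + (la * r) *: (c - p) = 0.
    by rewrite scale1r qE -scalerA -scalerDr h scaler0.
  have lar : 0 <= la * r by rewrite mulr_ge0// ltW.
  have [il|il] := eqVneq i' l'.
    exfalso; subst l'.
    by apply: (antiV i' q c 1 (la * r)) => //; rewrite ltr_pwDl.
  have il' : l' = i' -> False by move=> e'; rewrite e' eqxx in il.
  apply: (combine i' l' l' q c c 1 (la * r) 0) => //.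
  - by rewrite addr0 ltr_pwDl.
  - by rewrite scale0r addr0.
have [ij|ij] := eqVneq i j.
  by subst j; exact: (merge i l x y z al be ga).
have [il|il] := eqVneq i l.
  subst l; apply: (merge i j x z y al ga be) => //; first by rewrite addrAC.
  by rewrite addrAC.
have [jl|jl] := eqVneq j l.
  subst l; apply: (merge j i y z x be ga al) => //; first by rewrite addrC addrA.
  by rewrite addrC addrA.
have sym (a b : 'I_k) : a != b -> b = a -> False by move=> ab ba; rewrite ba eqxx in ab.
by apply: (combine i j l x y z al be ga) => //;
  [move/(sym _ _ ij)|move/(sym _ _ il)|move/(sym _ _ jl)].
Qed.
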